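(* Let $\Omega\subset\mathbb{R}^n$ be an open domain and let $U \subset L^2(\Omega; \mathbb{R}^m)$ have the form $$U = \{ u \in L^2(\Omega; \mathbb{R}^m) \mid u(x) \in C(x) \text{ for a.e. } x \in \Omega \}$$ for a Borel-measurable set-valued mapping $C: \Omega \rightrightarrows \mathbb{R}^m$ such that $C(x) \subset \mathbb{R}^m$ is geometrically derivable for almost every $x \in \Omega$. Then for every $u \in U$ we have $$\widehat N(u; U) = \{ z \in L^2(\Omega; \mathbb{R}^m) \mid z(x) \in \widehat N(u(x); C(x)) \text{ for a.e. } x \in \Omega \}$$ and $$T(u; U) = \{ z \in L^2(\Omega; \mathbb{R}^m) \mid z(x) \in T(u(x); C(x)) \text{ for a.e. } x \in \Omega \}.$$
   Context: For a Hilbert space $X$ (identified with its dual; this includes $\mathbb{R}^m$), a set $U\subset X$ and $u\in U$: - Fréchet (regular) normals: $\widehat N(u;U)=\{z\in X \mid \limsup_{U\ni u'\to u}\frac{\langle z,u'-u\rangle}{\|u'-u\|}\le 0\}$ (strong convergence). - Tangent vectors: $T(u;U)=\{z\in X\mid \text{there exist } \tau^i\searrow 0 \text{ and } u^i\in U \text{ with } z=\lim_{i\to\infty}(u^i-u)/\tau^i\}$. - A tangent vector $z\in T(u;U)$ is derivable if there exist $\varepsilon>0$ and a curve $\xi:[0,\varepsilon]\to U$ with $\xi(0)=u$ such that $\xi_+'(0)=\lim_{t\searrow 0}(\xi(t)-\xi(0))/t$ exists and equals $z$. The set $U$ is geometrically derivable if for every $u\in U$ every $z\in T(u;U)$ is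 derivable. *)

(* Defs.v *)
From HB Require Import structures.
From mathcomp Require Import all_boot all_order all_algebra.
From mathcomp Require Import all_classical all_reals all_analysis.
From mathcomp Require Import measurable_realfun ring lra.

Set Implicit Arguments.
Unset Strict Implicit.
Unset Printing Implicit Defensive.

Import Order.TTheory GRing.Theory Num.Theory.
Import numFieldNormedType.Exports.

Local Open Scope classical_set_scope.
Local Open Scope ring_scope.

Definition borel_display : measure_display.
Proof. exact: default_measure_display. Qed.

(* Borel sigma-algebra. The topology is the one of the max norm, that is, the
   usual one. *)
HB.instance Definition _ (R : realType) (m n : nat) :=
  @isMeasurable.Build borel_display 'M[R]_(m, n) <<s open >>
    (@sigma_algebra0 _ setT open) (@sigma_algebraC _ open)
    (@sigma_algebra_bigcup _ setT open).

Section borel_rV.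
Context {R : realType} {n : nat}.

Lemma measurable_mxE : @measurable _ 'rV[R]_n = <<s open >>.
Proof. by []. Qed.

Lemma open_measurable_rV (A : set 'rV[R]_n) : open A -> measurable A.
Proof. exact: sub_sigma_algebra. Qed.

Lemma measurable_coord (j : 'I_n) :
  measurable_fun [set: 'rV[R]_n] (fun v => v 0 j).
Proof.
apply: (measurability _ (RGenOpens.measurableE R)) => _ [_ [a [b ->] <-]].
rewrite setTI; apply: open_measurable_rV.
by apply: open_comp => [v _|]; [exact: coord_continuous|exact: interval_open].
Qed.

Definition rat_ball (q : 'rV[rat]_n * nat) : set 'rV[R]_n :=
  ball (map_mx ratr q.1 : 'rV[R]_n) q.2.+1%:R^-1.

Lemma open_rat_ball (V : set 'rV[R]_n) v : open V -> V v ->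
  exists2 q, rat_ball q v & rat_ball q `<=` V.
Proof.
move=> oV Vv; have : nbhs v V by exact: open_nbhs_nbhs.
move=> /nbhs_ballP[e /= e0 eV].
have [k ke] : exists k : nat, k.+1%:R^-1 < e / 2 :> R.
  have e2 : 0 < e / 2 by lra.
  have [k _ kP] := near_infty_natSinv_lt (PosNum e2).
  by exists k; exact: (kP k (leqnn k)).
have k0 : 0 < k.+1%:R^-1 :> R by rewrite invr_gt0.
have /choice[q qP] : forall j, exists q : rat,
    `|v 0 j - ratr q| < k.+1%:R^-1.
  move=> j; have := @rat_in_itvoo R (v 0 j) (v 0 j + k.+1%:R^-1).
  rewrite ltrDl => /(_ k0)[q]; rewrite in_itv/= => /andP[q1 q2]; exists q.
  rewrite ltr_distlC q2 andbT; apply: lt_trans q1.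
  by rewrite ltrBlDr ltrDl.
have vB : rat_ball (\row_j q j, k) v.
  by split=> // i j; rewrite ord1 !mxE /ball/= distrC; exact: qP.
exists (\row_j q j, k) => // w Bw.
apply: eV; apply: (@le_ball _ _ _ (k.+1%:R^-1 + k.+1%:R^-1)).
  by apply/ltW; rewrite [ltRHS]splitr ltrD.
exact: ball_triangle (ball_sym vB) Bw.
Qed.

Lemma measurable_fun_rVP d (T : measurableType d) (D : set T)
    (f : T -> 'rV[R]_n) :
  measurable_fun D f <-> forall j, measurable_fun D (fun x => f x 0 j).
Proof.
split=> [mf j|mf].
  exact: (measurableT_comp (f := fun v : 'rV[R]_n => v 0 j)
    (measurable_coord j)).
move=> mD; apply: (measurability _ measurable_mxE) (mD) => _ [V /= oV <-].
have -> : D `&` f @^-1` V =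
    \bigcup_(q : 'rV[rat]_n * nat)
      (if `[< rat_ball q `<=` V >] then D `&` f @^-1` rat_ball q else set0).
  apply/seteqP; split=> [x [Dx Vfx]|x [q _]]; last first.
    by case: ifPn => // /asboolP BV [Dx /BV].
  have [q Bq BV] := open_rat_ball oV Vfx.
  by exists q => //; rewrite asboolT.
apply: countable_bigcupT_measurable => // q.
case: ifPn => // _.
have -> : D `&` f @^-1` rat_ball q = D `&` \bigcap_(j in [set: 'I_n])
    (D `&` (fun x => f x 0 j) @^-1` ball (ratr (q.1 0 j) : R) q.2.+1%:R^-1).
  apply/seteqP; split=> x [Dx] /=.
    by move=> [_ Bfx]; split=> // j _; split=> //; have := Bfx 0 j; rewrite mxE.
  move=> Bfx; split=> //; split; first by rewrite invr_gt0.
  by move=> i j; rewrite ord1 mxE; exact: (Bfx j Logic.I).2.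
apply: measurableI => //; apply: fin_bigcap_measurable => // j _.
by apply: mf => //; apply: open_measurable; exact: ball_open.
Qed.

End borel_rV.

Section lebesgue_rV.
Context {R : realType}.

Definition rV_cons n (p : R * 'rV[R]_n) : 'rV[R]_n.+1 := row_mx p.1%:M p.2.

Lemma rV_consE0 n p : @rV_cons n p 0 0 = p.1.
Proof.
have -> : 0 = lshift n (0 : 'I_1) :> 'I_n.+1 by exact: val_inj.
by rewrite [LHS]row_mxEl mxE.
Qed.

Lemma rV_consES n p j : @rV_cons n p 0 (lift 0 j) = p.2 0 j.
Proof.
have -> : lift 0 j = rshift 1 j :> 'I_n.+1 by exact: val_inj.
by rewrite [LHS]row_mxEr.
Qed.

Lemma measurable_rV_cons n : measurable_fun setT (@rV_cons n).
Proof.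
apply/measurable_fun_rVP => j; have [k ->|->] := unliftP ord0 j.
- under eq_fun do rewrite rV_consES.
  apply: (measurableT_comp (measurable_coord k)); exact: measurable_snd.
- by under eq_fun do rewrite rV_consE0; exact: measurable_fst.
Qed.

Section lebesgue_cons.
Variables (n : nat) (mu : {sigma_finite_measure set 'rV[R]_n -> \bar R}).

(* Product of the Lebesgue measure on the first coordinate and of [mu] on the
   remaining ones. *)
Definition lebesgue_cons : set 'rV[R]_n.+1 -> \bar R :=
  pushforward (@lebesgue_measure R \x mu)%E (@rV_cons n).

Let lebesgue_cons0 : lebesgue_cons set0 = 0%E.
Proof. by rewrite /lebesgue_cons /pushforward preimage_set0 measure0. Qed.

Let lebesgue_cons_ge0 A : (0 <= lebesgue_cons A)%E.
Proof. exact: (measure_ge0 (@lebesgue_measure R \x mu)%E). Qed.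

Let lebesgue_cons_sigma_additive : semi_sigma_additive lebesgue_cons.
Proof.
exact: (@measure_semi_sigma_additive _ _ _
  (measure_function_pushforward__canonical__measure_function_Measure
    (@lebesgue_measure R \x mu)%E (@measurable_rV_cons n))).
Qed.

HB.instance Definition _ := isMeasure.Build _ _ _ lebesgue_cons
  lebesgue_cons0 lebesgue_cons_ge0 lebesgue_cons_sigma_additive.

Let lebesgue_cons_sigma_finite : sigma_finite setT lebesgue_cons.
Proof.
have /sigma_finiteP[F [TF ndF Foo]] := sigma_finiteT (@lebesgue_measure R).
have /sigma_finiteP[G [TG ndG Goo]] := sigma_finiteT mu.
pose H k (v : 'rV[R]_n.+1) := F k (v 0 0) /\ G k (\row_j v 0 (lift 0 j)).
have mtl : measurable_fun setT
    (fun v : 'rV[R]_n.+1 => \row_j v 0 (lift 0 j) : 'rV[R]_n).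
  apply/measurable_fun_rVP => j; under eq_fun do rewrite mxE.
  exact: measurable_coord.
have HE k : @rV_cons n @^-1` (H k) = F k `*` G k.
  apply/seteqP; split=> -[x v]; rewrite /H /= rV_consE0;
    rewrite (_ : \row_j _ = v)//;
    by apply/rowP => j; rewrite mxE rV_consES.
exists H => [|k].
  apply/esym; rewrite -subTset => v _.
  have [a _ Fa] : (\bigcup_i F i) (v 0 0) by rewrite -TF.
  have [b _ Gb] : (\bigcup_i G i) (\row_j v 0 (lift 0 j)) by rewrite -TG.
  exists (maxn a b) => //; split.
  - by move: Fa; exact/subsetPset/ndF/leq_maxl.
  - by move: Gb; exact/subsetPset/ndG/leq_maxr.
have [mF Fk] := Foo k; have [mG Gk] := Goo k; split.
  rewrite (_ : H k = (fun v : 'rV[R]_n.+1 => v 0 0) @^-1` F k `&`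
    (fun v : 'rV[R]_n.+1 => \row_j v 0 (lift 0 j)) @^-1` G k)//.
  apply: measurableI; rewrite -[X in measurable X]setTI;
    [exact: measurable_coord|exact: mtl].
rewrite /lebesgue_cons /pushforward HE product_measure1E//.
by rewrite lte_mul_pinfty// ge0_fin_numE.
Qed.

HB.instance Definition _ := Measure_isSigmaFinite.Build _ _ _ lebesgue_cons
  lebesgue_cons_sigma_finite.

End lebesgue_cons.

Fixpoint lebesgue_rV n : {sigma_finite_measure set 'rV[R]_n -> \bar R} :=
  match n return {sigma_finite_measure set 'rV[R]_n -> \bar R} with
  | 0 => \d_(0 : 'rV[R]_0)
  | n'.+1 => lebesgue_cons (lebesgue_rV n')
  end.

(* Normalization: boxes have the expected volume. *)
Lemma lebesgue_rV_box n (a b : 'rV[R]_n) : (forall j, a 0 j <= b 0 j) ->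
  lebesgue_rV n [set v | forall j, a 0 j <= v 0 j <= b 0 j] =
  (\prod_(j < n) (b 0 j - a 0 j))%:E.
Proof.
elim: n a b => [|n IH] a b ab.
  by rewrite big_ord0 /= diracE mem_set//= => -[].
rewrite big_ord_recl EFinM.
pose t (v : 'rV[R]_n.+1) : 'rV[R]_n := \row_j v 0 (lift 0 j).
pose B := [set v : 'rV[R]_n | forall j, t a 0 j <= v 0 j <= t b 0 j].
have mB : measurable B.
  have -> : B = \bigcap_(j in [set: 'I_n])
      (fun v : 'rV[R]_n => v 0 j) @^-1` `[t a 0 j, t b 0 j].
    apply/seteqP; split=> v h j; first by move=> _; rewrite /= in_itv/=; exact: h.
    by have := h j Logic.I; rewrite /= in_itv.
  apply: fin_bigcap_measurable => // j _.
  rewrite -[X in measurable X]setTI; exact: measurable_coord.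
have -> : (\prod_(i < n) (b 0 (lift ord0 i) - a 0 (lift ord0 i)))%:E =
    lebesgue_rV n B.
  rewrite IH; last by move=> j; rewrite !mxE.
  by congr EFin; apply: eq_bigr => j _; rewrite !mxE.
have -> : (b 0 ord0 - a 0 ord0)%:E = @lebesgue_measure R `[a 0 0, b 0 0].
  rewrite lebesgue_measure_itv/= lte_fin lt_neqAle ab andbT.
  by case: eqVneq => [->|]; rewrite ?subrr.
rewrite -product_measure1E//.
rewrite /= /lebesgue_cons /pushforward.
congr (product_measure1 _ _ _); apply/seteqP; split=> -[x v] /=.
  move=> h; split; first by have := h 0; rewrite rV_consE0 in_itv.
  by move=> j; have := h (lift 0 j); rewrite rV_consES !mxE.
move=> [hx hv] j; have [k ->|->] := unliftP 0 j.
  by have := hv k; rewrite rV_consES !mxE.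
by rewrite rV_consE0; move: hx; rewrite in_itv.
Qed.

Definition lebesgue_on n (Omega : set 'rV[R]_n) (oOmega : open Omega) :
    {measure set 'rV[R]_n -> \bar R} :=
  mrestr (lebesgue_rV n) (open_measurable_rV oOmega).

End lebesgue_rV.

Section dotrV.
Context {R : realType} {n : nat}.
Implicit Types u v : 'rV[R]_n.

Definition dotrV u v : R := \sum_(j < n) u 0 j * v 0 j.

Lemma dotrVC u v : dotrV u v = dotrV v u.
Proof. by apply: eq_bigr => j _; rewrite mulrC. Qed.

Lemma dotrVDl u u' v : dotrV (u + u') v = dotrV u v + dotrV u' v.
Proof. by rewrite -big_split; apply: eq_bigr => j _; rewrite mxE mulrDl. Qed.

Lemma dotrVZl a u v : dotrV (a *: u) v = a * dotrV u v.
Proof. by rewrite mulr_sumr; apply: eq_bigr => j _; rewrite mxE mulrA. Qed.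

Lemma dotrVv_ge0 u : 0 <= dotrV u u.
Proof. by apply: sumr_ge0 => j _; rewrite -expr2 sqr_ge0. Qed.

Lemma dotrVv_eq0 u : (dotrV u u == 0) = (u == 0).
Proof.
apply/idP/eqP => [|->]; last first.
  by rewrite /dotrV big1// => j _; rewrite mxE mul0r.
rewrite psumr_eq0 => [/allP u0|j _]; last by rewrite -expr2 sqr_ge0.
apply/rowP => j; apply/eqP; rewrite mxE.
by have := u0 j (mem_index_enum _); rewrite /= mulf_eq0 orbb.
Qed.

End dotrV.

Section inner_product_factory.
Context {R : realType} {V : lmodType R} (f : V -> V -> R).
Hypotheses (fC : forall u v, f u v = f v u)
  (fDl : forall u u' v, f (u + u') v = f u v + f u' v)
  (fZl : forall a u v, f (a *: u) v = a * f u v).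

Lemma inner_zmodl v : zmod_morphism (f ^~ v).
Proof.
move=> a b /=; apply: (addIr (f b v)).
by rewrite subrK -fDl subrK.
Qed.

Lemma inner_zmodr u : zmod_morphism (f u).
Proof. by move=> a b; rewrite fC inner_zmodl !(fC u). Qed.

Lemma inner_scalel v : scalable_for *%R (f ^~ v).
Proof. by move=> a b /=. Qed.

Lemma inner_scaler u : scalable_for (idfun \; *%R) (f u).
Proof. by move=> a b /=; rewrite fC fZl fC. Qed.

Lemma inner_herm u v : f u v = (-1) ^+ false * idfun (f v u).
Proof. by rewrite expr0 mul1r fC. Qed.

End inner_product_factory.

Section dotrV_inner.
Context {R : realType} {n : nat}.
Let dotrVC := @dotrVC R n.
Let dotrVDl := @dotrVDl R n.
Let dotrVZl := @dotrVZl R n.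

Let dotrV_gt0 (u : 'rV[R]_n) : u != 0 -> 0 < dotrV u u.
Proof. by move=> u0; rewrite lt_neqAle eq_sym dotrVv_eq0 u0 dotrVv_ge0. Qed.

HB.instance Definition _ := isBilinear.Build _ _ _ _ _ _ (@dotrV R n)
  (inner_zmodl dotrVDl) (inner_zmodr dotrVC dotrVDl)
  (inner_scalel dotrVZl) (inner_scaler dotrVC dotrVZl).
HB.instance Definition _ := isHermitianSesquilinear.Build _ _ _ _ (@dotrV R n)
  (inner_herm dotrVC).
HB.instance Definition _ := isDotProduct.Build _ _ (@dotrV R n) dotrV_gt0.
End dotrV_inner.

(* [f] is the inner product of [X]; the norm [dnorm f] is the one it induces and
   not the max norm that MathComp-Analysis puts on ['rV[R]_n]. *)
Section variational.
Context {R : realType} {X : lmodType R} (f : {dot X for idfun}).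
Implicit Types (U : set X) (u z : X).

Definition dnorm u : R := Num.sqrt (f u u).

(* The limsup over [v] in [U] tending to [u] is the infimum over [e > 0] of the
   suprema over [v] in [U] with [0 < |v - u| < e]; it is -oo if [u] is isolated
   in [U]. *)
Definition frechet_normal U u : set X :=
  [set z | (ereal_inf
     [set ereal_sup [set (f z (v - u) / dnorm (v - u))%:E
                    | v in U `&` [set v | (0 < dnorm (v - u) < e)%R]]
     | e in [set e : R | (0 < e)%R]] <= 0)%E].

Definition tangent U u : set X :=
  [set z | exists (tau : nat -> R) (w : nat -> X),
     [/\ forall i, 0 < tau i, tau i @[i --> \oo] --> 0,
         forall i, U (w i) &
         dnorm ((tau i)^-1 *: (w i - u) - z) @[i --> \oo] --> 0]].

Definition derivable_tangent U u z :=
  exists (e : R) (xi : R -> X),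
     [/\ 0 < e, forall t, 0 <= t <= e -> U (xi t), xi 0 = u &
         dnorm (t^-1 *: (xi t - xi 0) - z) @[t --> 0^'+] --> 0].

Definition geometrically_derivable U :=
  forall u, U u -> forall z, tangent U u z -> derivable_tangent U u z.

End variational.

Section L2.
Context d (T : measurableType d) (R : realType).
Variables (mu : {measure set T -> \bar R}) (m : nat).

Definition sq_integrable (u : T -> 'rV[R]_m) : bool :=
  (\int[mu]_x (dotrV (u x) (u x))%:E < +oo)%E.

(* L^2(mu; R^m): square-integrable classes of measurable functions modulo
   mu-a.e. equality. Any class modulo a.e. equality for the Lebesgue measure has
   a Borel measurable representative, and the functions are total because
   [lebesgue_on] does not charge the complement of the domain. *)
Record L2 := MkL2 {
  L2_class : {mfun_ mu, T >-> 'rV[R]_m} ;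
  _ : sq_integrable L2_class }.

HB.instance Definition _ := [isSub for L2_class].
HB.instance Definition _ := [Choice of L2 by <:].

(* The values of [u] are those of a chosen representative, hence they are
   meaningful only up to a null set. *)
Definition L2_fun (u : L2) : T -> 'rV[R]_m := L2_class u.
Coercion L2_fun : L2 >-> Funclass.

Lemma measurable_L2 (u : L2) : measurable_fun setT u.
Proof. exact: measurable_funPT. Qed.

Lemma L2_sq_integrable (u : L2) : sq_integrable u.
Proof. by case: u. Qed.

Lemma L2P (u v : L2) : {ae mu, forall x, u x = v x} -> u = v.
Proof.
move=> uv; apply/val_inj; rewrite -[LHS]reprK -[RHS]reprK; apply/eqP/ae_eqP.
by apply: filterS uv => x + _.
Qed.

Lemma measurable_dotrV (u v : T -> 'rV[R]_m) :
  measurable_fun setT u -> measurable_fun setT v ->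
  measurable_fun setT (fun x => dotrV (u x) (v x)).
Proof.
move=> /measurable_fun_rVP mu_ /measurable_fun_rVP mv.
by apply: measurable_sum => j; apply: measurable_funM.
Qed.

Section mkL2.
Variables (u : T -> 'rV[R]_m) (mu_ : measurable_fun setT u)
  (iu : sq_integrable u).

Let u_mfun : {mfun T >-> 'rV[R]_m} :=
  HB.pack u (isMeasurableFun.Build _ _ _ _ u mu_).

Let u_class : {mfun_ mu, T >-> 'rV[R]_m} := \pi_({mfun_ mu, T >-> 'rV[R]_m})%qT u_mfun.

Lemma u_classE : {ae mu, forall x, u_class x = u x}.
Proof.
have : repr u_class = u_mfun %[mod {mfun_ mu, T >-> 'rV[R]_m}]%qT.
  by rewrite reprK.
move=> /eqP; rewrite eqmodE => /asboolP.
by apply: filterS => x /(_ Logic.I).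
Qed.

Let u_class_sq_integrable : sq_integrable u_class.
Proof.
rewrite /sq_integrable (@ge0_ae_eq_integral _ _ _ mu setT _
  (fun x => (dotrV (u x) (u x))%:E))//.
- by apply/measurable_EFinP; apply: measurable_dotrV; exact: measurable_funPT.
- by apply/measurable_EFinP; exact: measurable_dotrV.
- by move=> x _; rewrite lee_fin dotrVv_ge0.
- by move=> x _; rewrite lee_fin dotrVv_ge0.
- by apply: filterS u_classE => x -> _.
Qed.

Definition mkL2 : L2 := MkL2 u_class_sq_integrable.

Lemma mkL2E : {ae mu, forall x, mkL2 x = u x}.
Proof. exact: u_classE. Qed.

End mkL2.

Lemma dotrV_le (a b : 'rV[R]_m) :
  `|dotrV a b| <= dotrV a a + dotrV b b.
Proof.
rewrite -big_split; apply: le_trans (ler_norm_sum _ _ _) _.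
by apply: ler_sum => j _ /=; rewrite ler_norml; apply/andP; split; nra.
Qed.

Lemma sq_integrableP (u : T -> 'rV[R]_m) : measurable_fun setT u ->
  sq_integrable u -> mu.-integrable setT (fun x => (dotrV (u x) (u x))%:E).
Proof.
move=> mu_ iu; apply/integrableP; split.
  by apply/measurable_EFinP; exact: measurable_dotrV.
under eq_integral do rewrite gee0_abs ?lee_fin ?dotrVv_ge0//.
exact: iu.
Qed.

Lemma integrable_dotrV (u v : T -> 'rV[R]_m) :
  measurable_fun setT u -> measurable_fun setT v ->
  sq_integrable u -> sq_integrable v ->
  mu.-integrable setT (fun x => (dotrV (u x) (v x))%:E).
Proof.
move=> mu_ mv iu iv.
apply: (le_integrable measurableT _ _
  (integrableD measurableT (sq_integrableP mu_ iu) (sq_integrableP mv iv))).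
  by apply/measurable_EFinP; exact: measurable_dotrV.
move=> x _; rewrite /= lee_fin.
by rewrite [leRHS]ger0_norm ?addr_ge0 ?dotrVv_ge0// dotrV_le.
Qed.

Lemma measurable_rVD (u v : T -> 'rV[R]_m) : measurable_fun setT u ->
  measurable_fun setT v -> measurable_fun setT (fun x => u x + v x).
Proof.
move=> /measurable_fun_rVP mu_ /measurable_fun_rVP mv.
apply/measurable_fun_rVP => j; under eq_fun do rewrite mxE.
exact: measurable_funD.
Qed.

Lemma measurable_rVZ a (u : T -> 'rV[R]_m) : measurable_fun setT u ->
  measurable_fun setT (fun x => a *: u x).
Proof.
move=> /measurable_fun_rVP mu_.
apply/measurable_fun_rVP => j; under eq_fun do rewrite mxE.
exact: measurable_funM.
Qed.

Lemma sq_integrableD (u v : T -> 'rV[R]_m) : measurable_fun setT u ->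
  measurable_fun setT v -> sq_integrable u -> sq_integrable v ->
  sq_integrable (fun x => u x + v x).
Proof.
move=> mu_ mv iu iv.
have I := integrableD measurableT
  (integrableD measurableT (sq_integrableP mu_ iu) (sq_integrableP mv iv))
  (integrableD measurableT (integrable_dotrV mu_ mv iu iv)
    (integrable_dotrV mv mu_ iv iu)).
case/integrableP: (I) => _; apply: le_lt_trans; rewrite /sq_integrable.
apply: ge0_le_integral => //.
- by move=> x _; rewrite lee_fin dotrVv_ge0.
- apply/measurable_EFinP.
  by apply: measurable_dotrV; exact: measurable_rVD.
- exact: measurableT_comp (measurable_int _ I).
move=> x _; rewrite /= lee_fin; apply: le_trans (ler_norm _).
by rewrite dotrVDl ![dotrV _ (_ + _)]dotrVC !dotrVDl; lra.
Qed.

Lemma sq_integrableZ a (u : T -> 'rV[R]_m) : measurable_fun setT u ->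
  sq_integrable u -> sq_integrable (fun x => a *: u x).
Proof.
move=> mu_ iu; rewrite /sq_integrable.
under eq_integral do rewrite dotrVZl dotrVC dotrVZl mulrA EFinM.
rewrite ge0_integralZl//.
- by rewrite lte_mul_pinfty// lee_fin -expr2 sqr_ge0.
- by apply/measurable_EFinP; exact: measurable_dotrV.
- by move=> x _; rewrite lee_fin dotrVv_ge0.
- by rewrite lee_fin -expr2 sqr_ge0.
Qed.

Definition L2_add (u v : L2) : L2 :=
  mkL2 (measurable_rVD (measurable_L2 u) (measurable_L2 v))
    (sq_integrableD (measurable_L2 u) (measurable_L2 v)
      (L2_sq_integrable u) (L2_sq_integrable v)).

Definition L2_scale a (u : L2) : L2 :=
  mkL2 (measurable_rVZ a (measurable_L2 u))
    (sq_integrableZ a (measurable_L2 u) (L2_sq_integrable u)).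

Lemma sq_integrable0 : sq_integrable (fun=> 0).
Proof.
rewrite /sq_integrable integral0_eq// => x _.
by congr EFin; apply/eqP; rewrite dotrVv_eq0.
Qed.

Lemma measurable_rV0 : measurable_fun setT (fun _ : T => 0 : 'rV[R]_m).
Proof. exact: measurable_cst. Qed.

Definition L2_zero : L2 := mkL2 measurable_rV0 sq_integrable0.

Let L2_opp (u : L2) := L2_scale (-1) u.

Let addE (u v : L2) : {ae mu, forall x, L2_add u v x = u x + v x}.
Proof. exact: mkL2E. Qed.
Let scaleE a (u : L2) : {ae mu, forall x, L2_scale a u x = a *: u x}.
Proof. exact: mkL2E. Qed.
Let zeroE : {ae mu, forall x, L2_zero x = 0}.
Proof. exact: mkL2E. Qed.

Let L2_addA : associative L2_add.
Proof.
move=> u v w; apply: L2P.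
by apply: filterS (filterI (addE u (L2_add v w))
    (filterI (addE v w)
    (filterI (addE (L2_add u v) w)
    (addE u v)))) => x [-> [-> [-> ->]]]; rewrite addrA.
Qed.

Let L2_addC : commutative L2_add.
Proof.
move=> u v; apply: L2P.
by apply: filterS (filterI (addE u v)
    (addE v u)) => x [-> ->]; rewrite addrC.
Qed.

Let L2_add0 : left_id L2_zero L2_add.
Proof.
move=> u; apply: L2P.
by apply: filterS (filterI (addE L2_zero u)
    (zeroE)) => x [-> ->]; rewrite add0r.
Qed.

Let L2_addN : left_inverse L2_zero L2_opp L2_add.
Proof.
move=> u; apply: L2P.
apply: filterS (filterI (addE (L2_opp u) u)
    (filterI (zeroE)
    (scaleE (-1) u))) => x [-> [-> ->]].
by rewrite scaleN1r addNr.
Qed.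

HB.instance Definition _ := GRing.isZmodule.Build L2
  L2_addA L2_addC L2_add0 L2_addN.

Let L2_scaleA a b (u : L2) : L2_scale a (L2_scale b u) = L2_scale (a * b) u.
Proof.
apply: L2P; apply: filterS (filterI (scaleE a (L2_scale b u))
    (filterI (scaleE b u)
    (scaleE (a * b) u))) => x [-> [-> ->]].
by rewrite scalerA.
Qed.

Let L2_scale1 : left_id 1 L2_scale.
Proof.
by move=> u; apply: L2P; apply: filterS (scaleE 1 u) => x ->; rewrite scale1r.
Qed.

Let L2_scaleDr : right_distributive L2_scale +%R.
Proof.
move=> a u v; apply: L2P.
apply: filterS (filterI (scaleE a (u + v))
    (filterI (addE u v)
    (filterI (addE (L2_scale a u) (L2_scale a v))
    (filterI (scaleE a u)
    (scaleE a v))))) => x [-> [-> [-> [-> ->]]]].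
by rewrite scalerDr.
Qed.

Let L2_scaleDl u : {morph L2_scale^~ u : a b / a + b}.
Proof.
move=> a b; apply: L2P.
apply: filterS (filterI (scaleE (a + b) u)
    (filterI (addE (L2_scale a u) (L2_scale b u))
    (filterI (scaleE a u)
    (scaleE b u)))) => x [-> [-> [-> ->]]].
by rewrite scalerDl.
Qed.

HB.instance Definition _ := GRing.Zmodule_isLmodule.Build R L2
  L2_scaleA L2_scale1 L2_scaleDr L2_scaleDl.

Lemma L2_0E : {ae mu, forall x, (0 : L2) x = 0}. Proof. exact: zeroE. Qed.

Lemma L2_addE (u v : L2) : {ae mu, forall x, (u + v) x = u x + v x}.
Proof. exact: addE. Qed.

Lemma L2_scaleE a (u : L2) : {ae mu, forall x, (a *: u) x = a *: u x}.
Proof. exact: scaleE. Qed.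

Definition dotL2 (u v : L2) : R := \int[mu]_x dotrV (u x) (v x).

Let integrable_dot (u v : L2) :
  mu.-integrable setT (fun x => (dotrV (u x) (v x))%:E).
Proof.
by apply: integrable_dotrV;
  [exact: measurable_L2|exact: measurable_L2|exact: L2_sq_integrable|
   exact: L2_sq_integrable].
Qed.

Let dotL2C (u v : L2) : dotL2 u v = dotL2 v u.
Proof. by apply: eq_Rintegral => x _; rewrite dotrVC. Qed.

Let dotL2Dl (u u' v : L2) : dotL2 (u + u') v = dotL2 u v + dotL2 u' v.
Proof.
rewrite /dotL2 -RintegralD//; [|exact: integrable_dot..].
rewrite /Rintegral; congr fine; apply: ae_eq_integral => //.
- exact: measurable_int (integrable_dot _ _).
- have /= := integrableD measurableT (integrable_dot u v) (integrable_dot u' v).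
  by move=> /measurable_int.
- by apply: filterS (L2_addE u u') => x -> _; rewrite dotrVDl.
Qed.

Let dotL2Zl a (u v : L2) : dotL2 (a *: u) v = a * dotL2 u v.
Proof.
rewrite /dotL2 -RintegralZl//; last exact: integrable_dot.
rewrite /Rintegral; congr fine; apply: ae_eq_integral => //.
- exact: measurable_int (integrable_dot _ _).
- have /= := integrableZl measurableT a (integrable_dot u v).
  by move=> /measurable_int.
- by apply: filterS (L2_scaleE a u) => x -> _; rewrite dotrVZl.
Qed.

Let dotL2_gt0 (u : L2) : u != 0 -> 0 < dotL2 u u.
Proof.
move=> u0; rewrite lt_neqAle; apply/andP; split; last first.
  by apply: Rintegral_ge0 => x _; exact: dotrVv_ge0.
apply: contra_neq u0 => u0; apply: L2P.
have iu : (\int[mu]_x (dotrV (u x) (u x))%:E = 0)%E.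
  rewrite -[LHS]fineK ?[fine _](esym u0)//.
  exact: integrable_fin_num (integrable_dot u u).
have : ae_eq mu setT (fun x => (dotrV (u x) (u x))%:E) (cst 0%E).
  apply/ae_eq_integral_abs => //; first exact: measurable_int (integrable_dot _ _).
  by under eq_integral do rewrite gee0_abs ?lee_fin ?dotrVv_ge0//.
move=> h; apply: filterS (filterI h L2_0E) => x [/(_ Logic.I) /= [] /eqP + ->].
by rewrite dotrVv_eq0 => /eqP.
Qed.

HB.instance Definition _ := isBilinear.Build _ _ _ _ _ _ dotL2
  (inner_zmodl dotL2Dl) (inner_zmodr dotL2C dotL2Dl)
  (inner_scalel dotL2Zl) (inner_scaler dotL2C dotL2Zl).
HB.instance Definition _ := isHermitianSesquilinear.Build _ _ _ _ dotL2
  (inner_herm dotL2C).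
HB.instance Definition _ := isDotProduct.Build _ _ dotL2 dotL2_gt0.

End L2.
Arguments dotL2 {d T R mu m} u v.

(* Borel measurability of the set-valued map C : Omega => R^m in the sense of
   Aumann (Integrals of set-valued functions, 1965): the graph is a Borel set.
   The sigma-algebra of the product is that of the Borel sets of R^n x R^m.
   For closed-valued maps this follows from the Borel measurability of the
   preimages {x | C(x) meets V} of the open sets V (borel_setvalued_closed
   below). Values need not be closed here, and then preimages of open sets only
   determine the closure of C(x), so that they are not the right notion. *)
Definition borel_setvalued {R : realType} {n m : nat} (Omega : set 'rV[R]_n)
    (C : 'rV[R]_n -> set 'rV[R]_m) :=
  measurable [set p : 'rV[R]_n * 'rV[R]_m | Omega p.1 /\ C p.1 p.2].

Lemma borel_setvalued_closed {R : realType} {n m : nat} (Omega : set 'rV[R]_n)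
    (C : 'rV[R]_n -> set 'rV[R]_m) :
  measurable Omega -> (forall x, Omega x -> closed (C x)) ->
  (forall V, open V -> measurable [set x | Omega x /\ C x `&` V !=set0]) ->
  borel_setvalued Omega C.
Proof.
move=> mO cC mC; rewrite /borel_setvalued.
have -> : [set p : 'rV[R]_n * 'rV[R]_m | Omega p.1 /\ C p.1 p.2] =
    Omega `*` setT `\` \bigcup_(q : 'rV[rat]_m * nat)
      (~` [set x | Omega x /\ C x `&` rat_ball q !=set0] `*` rat_ball q).
  apply/seteqP; split=> -[x y] /=.
    move=> [Ox Cy]; split=> // -[q _ [/= + Bq]]; apply; split=> //.
    by exists y.
  move=> [[Ox _] nq]; split=> //; apply: contrapT => nCy.
  have oC : open (~` C x) by rewrite openC; exact: cC.
  have [q Bq qC] := open_rat_ball oC nCy.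
  apply: nq; exists q => //; split=> //= -[_ [w [Cw /qC]]].
  exact.
apply: measurableD; first exact: measurableX.
apply: countable_bigcupT_measurable => // q.
have oB : open (rat_ball q : set 'rV[R]_m) by exact: ball_open.
by apply: measurableX; [apply: measurableC; exact: mC|exact: open_measurable_rV].
Qed.

(* Main.v *)
(* The key tool is a measurable selection theorem modulo null sets. A
   measurable set [G] of [X * R^m] is the result of a Suslin operation on
   rectangles [A `*` F] with [A] measurable and [F] closed. Replacing, for every
   finite sequence [s], the set of the [x] that have a branch through [s] by a
   measurable hull [H s], the set [H s] is contained in the union of the
   [H (rcons s a)] up to a null set; away from these countably many null sets,
   following the least possible [a] at each step gives a measurable branch, and
   its limit is a selection of [G].

   Tangents: an L^2-convergent sequence of difference quotients has an a.e.
   convergent subsequence. Conversely, for small [t], derivability provides at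
   almost every [x] points of [C x] at distance [o(t)] of [u x + t *: z x];
   select them on a set of finite measure and keep [u] elsewhere.

   Normals: the pointwise inclusion gives the L^2 one by dominated convergence.
   If [z x] is not normal on a set that is not null, then by derivability there
   are, at a uniform rate and for all small [t], points [y] of [C x] with
   [|y - u x| = O(t)] and [z x . (y - u x) >= c t]; select them on a fixed
   set of finite positive measure to contradict the normality of [z]. *)
Require Import Defs.
From HB Require Import structures.
From mathcomp Require Import all_boot all_order all_algebra.
From mathcomp Require Import all_classical all_reals all_analysis.
From mathcomp Require Import measurable_realfun ring lra.

Set Implicit Arguments.
Unset Strict Implicit.
Unset Printing Implicit Defensive.

Import Order.TTheory GRing.Theory Num.Theory.
Import numFieldNormedType.Exports.

Local Open Scope classical_set_scope.
Local Open Scope ring_scope.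

Lemma natSinv_lt (R : realType) (e : R) : 0 < e ->
  exists k : nat, forall i, (k <= i)%N -> i.+1%:R^-1 < e.
Proof.
by move=> e0; have [k _ kP] := near_infty_natSinv_lt (PosNum e0); exists k.
Qed.

(** * Suslin representation of measurable sets *)

Section suslin.
Context d (X : measurableType d) (R : realType) (m : nat).
Local Notation Y := 'rV[R]_m.

Definition agree (k : nat) (t t' : nat -> nat) := forall i, (i < k)%N -> t i = t' i.

(* The conditions of index [k] depend only on the first [k] terms of [t]. The
   vanishing diameters make [y] a function of [t], so that selecting a branch
   selects a point. *)
Definition suslin (G : set (X * Y)) :=
  exists (A : nat -> (nat -> nat) -> set X) (F : nat -> (nat -> nat) -> set Y),
  [/\ forall k t t', agree k t t' -> A k t = A k t' /\ F k t = F k t',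
      forall k t, measurable (A k t),
      forall k t, closed (F k t),
      forall t (e : R), 0 < e ->
        exists k, forall y y', F k t y -> F k t y' -> `|y - y'| <= e &
      forall x y, G (x, y) <-> exists t, forall k, A k t x /\ F k t y].

Let dense_seq : exists q : nat -> Y,
  forall (y : Y) (e : R), 0 < e -> exists n, `|y - q n| <= e.
Proof.
exists (fun n => map_mx ratr (odflt 0 (unpickle n : option 'rV[rat]_m))) => y e e0.
have [q Bq qB] := open_rat_ball (@ball_open _ _ y e) (ballxx y e0).
exists (pickle q.1); rewrite pickleK /=; apply/ltW.
have := qB (map_mx ratr q.1) (ballxx _ _); rewrite -ball_normE; apply.
by rewrite invr_gt0.
Qed.

(** A branch is a sequence of indices of ever better approximations [q (t j)] of [y], which makes
    the diameters vanish. The set of index 0 is all of [V], since it may read no term of [t]. *)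
Lemma suslin_setX (A : set X) (V : set Y) : measurable A -> closed V ->
  suslin (A `*` V).
Proof.
move=> mA cV; have [q q_dense] := dense_seq.
pose F k (t : nat -> nat) : set Y := V `&`
  (if k is j.+1 then [set y | `|y - q (t j)| <= j.+1%:R^-1] else setT).
exists (fun _ _ => A), F; split.
- by move=> [|k] t t' tt'; split; rewrite /F ?tt'.
- by [].
- move=> [|k] t; rewrite /F; first by apply: closedI => //; exact: closedT.
  apply: closedI => //.
  have := @closed_ball_closed _ Y (q (t k)) (k.+1%:R^-1).
  rewrite closed_ballE ?invr_gt0// /closed_ball_ /=.
  by congr closed; apply/funext => y /=; rewrite distrC.
- move=> t e e0.
  have e2 : 0 < e / 2 by lra.
  have [k /(_ k (leqnn k)) kP] := natSinv_lt e2.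
  exists k.+1 => y y' [_ /= h] [_ /= h'].
  apply: le_trans (ler_distD (q (t k)) y y') _; rewrite (distrC (q _)).
  by rewrite [leRHS]splitr lerD// (le_trans _ (ltW kP)).
- move=> x y; split=> [[/= Ax Vy]|[t h]]; last by have [? []] := h 0%N.
  have /choice[t tP] : forall k, exists n, `|y - q n| <= k.+1%:R^-1.
    by move=> k; apply: q_dense; rewrite invr_gt0.
  by exists t => k; split=> //; split=> //; case: k => [|k] //=.
Qed.

(** The first term of a branch chooses the set [G i], and the remaining terms form a branch for it.
    Conditions are shifted by one, because at index 0 the choice of [i] is not yet visible. *)
Lemma suslin_bigcup (G : nat -> set (X * Y)) : (forall i, suslin (G i)) ->
  suslin (\bigcup_i G i).
Proof.
move=> /choice[A] /choice[F AF].
exists (fun k t => if k is j.+1 then A (t 0%N) j (t \o S) else setT).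
exists (fun k t => if k is j.+1 then F (t 0%N) j (t \o S) else setT).
split.
- move=> [|k] t t' tt' //; rewrite (tt' 0%N)//.
  by have [+ _ _ _ _] := AF (t' 0%N); apply => i ik /=; exact: tt'.
- by move=> [|k] t //; have [] := AF (t 0%N).
- by move=> [|k] t; [exact: closedT|have [] := AF (t 0%N)].
- move=> t e e0; have [_ _ _ + _] := AF (t 0%N).
  by move=> /(_ (t \o S) _ e0)[k kP]; exists k.+1.
- move=> x y; split.
    move=> [i _]; have [_ _ _ _ ->] := AF i => -[t tP].
    by exists (fun k => if k is j.+1 then t j else i) => -[|k]//; exact: tP.
  move=> [t tP]; exists (t 0%N) => //; have [_ _ _ _ ->] := AF (t 0%N).
  by exists (t \o S) => k; exact: (tP k.+1).
Qed.

(* [2 ^ i * 3 ^ n] codes the pair [(i, n)]; it is increasing in [n] and it is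
   decoded by [logn 2] and [logn 3]. *)
Lemma logn23 i j : (logn 2 (2 ^ i * 3 ^ j) = i) * (logn 3 (2 ^ i * 3 ^ j) = j).
Proof.
by rewrite !lognM ?expn_gt0// !lognX !logn_prime//= !muln0 !muln1 addn0.
Qed.

(** Locality of the interleaving of branches below: what condition [logn 3 k] reads in branch
    [logn 2 k] is stored among the first [k] terms of the coding sequence. *)
Lemma ltn_pair23 n k : (n < logn 3 k)%N -> (2 ^ logn 2 k * 3 ^ n < k)%N.
Proof.
case: k => [|k]; first by rewrite logn0.
move=> nk; apply: (@leq_trans (2 ^ logn 2 k.+1 * 3 ^ logn 3 k.+1)%N).
  by rewrite ltn_pmul2l ?expn_gt0// ltn_exp2l.
apply: dvdn_leq => //; rewrite Gauss_dvd ?pfactor_dvdnn//.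
by apply: coprimeXl; apply: coprimeXr.
Qed.

(** One sequence stores a branch [sub t i] for every [G i], and condition [k] is condition
    [logn 3 k] of [G (logn 2 k)]. For the diameters it is enough to look at [G 0]. *)
Lemma suslin_bigcap (G : nat -> set (X * Y)) : (forall i, suslin (G i)) ->
  suslin (\bigcap_i G i).
Proof.
move=> /choice[A] /choice[F AF].
pose sub (t : nat -> nat) i n := t (2 ^ i * 3 ^ n)%N.
exists (fun k t => A (logn 2 k) (logn 3 k) (sub t (logn 2 k))).
exists (fun k t => F (logn 2 k) (logn 3 k) (sub t (logn 2 k))).
split.
- move=> k t t' tt'; have [+ _ _ _ _] := AF (logn 2 k); apply => n nk.
  by apply: tt'; exact: ltn_pair23.
- by move=> k t; have [] := AF (logn 2 k).
- by move=> k t; have [] := AF (logn 2 k).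
- move=> t e e0; have [_ _ _ + _] := AF 0%N.
  move=> /(_ (sub t 0%N) _ e0)[k kP]; exists (2 ^ 0 * 3 ^ k)%N.
  by rewrite !logn23.
- move=> x y; split.
    move=> h; have /choice[t tP] : forall i, exists t,
        forall k, A i k t x /\ F i k t y.
      by move=> i; have [_ _ _ _ <-] := AF i; exact: h.
    exists (fun k => t (logn 2 k) (logn 3 k)) => k.
    rewrite (_ : sub _ _ = t (logn 2 k)); first exact: tP.
    by apply/funext => n; rewrite /sub !logn23.
  move=> [t tP] i _; have [_ _ _ _ ->] := AF i.
  by exists (sub t i) => k; have := tP (2 ^ i * 3 ^ k)%N; rewrite !logn23.
Qed.

(** An open set is the countable union of the closed sets [W i] of the points at distance at least
    [1 / (i + 1)] from its complement. *)
Lemma suslin_setX_open (A : set X) (V : set Y) : measurable A -> open V ->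
  suslin (A `*` V).
Proof.
move=> mA oV.
pose W i := ~` \bigcup_(z in ~` V) ball z (i.+1%:R^-1 : R).
have -> : A `*` V = \bigcup_i (A `*` W i) :> set (X * Y).
  apply/seteqP; split=> [[x y] [/= Ax Vy]|[x y] [i _ [/= Ax Wy]]]; last first.
    split=> //=; apply: contrapT => nVy; apply: Wy; exists y => //.
    by apply: ballxx; rewrite invr_gt0.
  have /nbhs_ballP[e /= e0 eV] : nbhs y V by exact: open_nbhs_nbhs.
  have [i /(_ i (leqnn i)) ie] := natSinv_lt e0.
  exists i => //; split=> //= -[z nVz /ball_sym zy]; apply/nVz/eV.
  by apply: le_ball zy; exact: ltW.
apply: suslin_bigcup => i; apply: suslin_setX => //.
by rewrite closedC; apply: bigcup_open => z _; exact: ball_open.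
Qed.

(** Suslin sets need not be stable under complement, but the sets that are Suslin together with
    their complement form a sigma-algebra [bi]. It contains the measurable cylinders over [X] and
    the open cylinders over [Y], which generate the product. *)
Lemma suslin_measurable (G : set (X * Y)) : measurable G -> suslin G.
Proof.
have s0 : suslin set0 by have := suslin_setX measurableT closed0; rewrite setX0.
pose bi (G : set (X * Y)) := suslin G /\ suslin (~` G).
have sT : suslin setT by have := suslin_setX measurableT closedT; rewrite setXTT.
have bi0 : bi set0 by rewrite /bi setC0.
have biC G' : bi G' -> bi (~` G') by rewrite /bi setCK => -[].
have biU (G_ : nat -> set (X * Y)) : (forall i, bi (G_ i)) -> bi (\bigcup_i G_ i).
  move=> h; split; first by apply: suslin_bigcup => i; case: (h i).
  by rewrite setC_bigcup; apply: suslin_bigcap => i; case: (h i).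
suff : measurable `<=` bi by move=> h /h[].
apply: smallest_sub; first by split=> // G' /biC; rewrite setTD.
move=> _ [[A mA <-]|[V mV <-]]; rewrite setTI.
  split; last rewrite preimage_setC; rewrite -setXT.
    by apply: suslin_setX_open => //; exact: openT.
  by apply: suslin_setX_open; [exact: measurableC|exact: openT].
move: V mV; apply: smallest_sub.
  split=> /= [|B mB|B mB]; first by rewrite preimage_set0.
    by rewrite setTD -preimage_setC; exact: biC.
  by rewrite preimage_bigcup; exact: biU.
move=> V oV /=; split; last rewrite preimage_setC; rewrite -setTX.
  exact: suslin_setX_open.
by apply: suslin_setX => //; exact: open_closedC.
Qed.
End suslin.

(** * Measurable selection *)

Section hull.
Context d (X : measurableType d) (R : realType).
Variable mu : {measure set X -> \bar R}.

(** The hull is the intersection of a sequence of measurable supersets of [E] minimizing the measure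
    inside [F]. If a superset [M] cut off positive mass from it, then [H]&[M] would lie below the
    infimum. *)
Lemma measurable_hull_finite (F E : set X) : measurable F -> (mu F < +oo)%E ->
  exists H, [/\ measurable H, E `<=` H &
    forall M, measurable M -> E `<=` M -> mu ((H `&` F) `\` M) = 0%E].
Proof.
move=> mF Foo.
pose S := [set mu (M `&` F) | M in [set M | measurable M /\ E `<=` M]].
pose I := ereal_inf S.
have finS M : measurable M -> mu (M `&` F) \is a fin_num.
  move=> mM; rewrite ge0_fin_numE//; apply: le_lt_trans Foo.
  by apply: le_measure; rewrite ?inE//; exact: measurableI.
have I0 : (0 <= I)%E by apply: le_ereal_inf_tmp => _ [M _ <-].
have ES : S (mu (setT `&` F)) by exists setT.
have finI : I \is a fin_num.
  by rewrite ge0_fin_numE//; apply: le_lt_trans (ereal_inf_lbound ES) _; rewrite setTI.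
have /choice[M_ MP] : forall n : nat, exists M, [/\ measurable M, E `<=` M &
    (mu (M `&` F) < I + (n.+1%:R^-1)%:E)%E].
  move=> n; have n0 : 0 < n.+1%:R^-1 :> R by rewrite invr_gt0.
  by have [_ [M [mM EM] <-]] := lb_ereal_inf_adherent n0 finI; exists M.
have mH : measurable (\bigcap_n M_ n).
  by apply: bigcapT_measurable => n; have [] := MP n.
exists (\bigcap_n M_ n); split=> // [x Ex n _|M mM EM].
  by have [_ + _] := MP n; exact.
set H := \bigcap_n _ in mH *.
have mHF : measurable (H `&` F) by exact: measurableI.
have EH : E `<=` H by move=> x Ex n _; have [_ + _] := MP n; exact.
apply/eqP; rewrite -measure_le0; apply/lee_addgt0Pr => e e0.
have [n /(_ n (leqnn n)) ne] := natSinv_lt e0.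
have IM : (I <= mu ((H `&` F) `&` M))%E.
  apply: ereal_inf_lbound; exists (H `&` M); last by rewrite setIAC.
  by split; [exact: measurableI|rewrite subsetI].
have [mMn _ Mn] := MP n.
rewrite add0e -(leeD2rE _ _ finI); apply: le_trans (leeD2l _ IM) _.
rewrite -measureDI//.
have HM : (mu (H `&` F) <= mu (M_ n `&` F))%E.
  apply: le_measure; rewrite ?inE//; first exact: measurableI.
  by apply: setSI => x; exact.
apply: le_trans HM _; apply: le_trans (ltW Mn) _.
by rewrite addeC leeD2r// lee_fin ltW.
Qed.

(** The hulls relative to the pieces of a sigma-finite cover are intersected: on each [F n] the
    result is contained in the hull that is minimal there. *)
Lemma measurable_hull (E : set X) : sigma_finite setT mu ->
  exists H, [/\ measurable H, E `<=` H &
    forall M, measurable M -> E `<=` M -> mu.-negligible (H `\` M)].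
Proof.
move=> [F UF mF].
have /choice[H_ HP] := fun n => measurable_hull_finite E (mF n).1 (mF n).2.
have mH : measurable (\bigcap_n H_ n).
  by apply: bigcapT_measurable => n; have [] := HP n.
exists (\bigcap_n H_ n); split=> // [x Ex n _|M mM EM].
  by have [_ + _] := HP n; exact.
apply: (@negligibleS _ _ _ _ (\bigcup_n ((H_ n `&` F n) `\` M))).
  move=> x [Hx nMx].
  have [n _ Fx] : (\bigcup_n F n) x by rewrite -UF.
  by exists n => //; split=> //; split=> //; exact: Hx.
apply: negligible_bigcup => n; have [mHn _ /(_ M mM EM) h] := HP n.
apply/negligibleP => //; apply: measurableD => //.
by apply: measurableI => //; exact: (mF n).1.
Qed.

End hull.

Section selection.
Context d (X : measurableType d) (R : realType) (m : nat).
Local Notation Y := 'rV[R]_m.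
Variable mu : {measure set X -> \bar R}.

Lemma measurable_selection (G : set (X * Y)) : sigma_finite setT mu ->
  measurable G ->
  exists (B : set X) (v : X -> Y), [/\ measurable B, measurable_fun setT v,
    forall x, B x -> G (x, v x) &
    mu.-negligible ([set x | exists y, G (x, y)] `\` B)].
Proof.
move=> sf /suslin_measurable[A [F [loc mA cF small GE]]].
pose P (s : seq nat) y := forall l, (l <= size s)%N -> F l (nth 0%N s) y.
pose E (s : seq nat) := [set x | exists t y,
  agree (size s) t (nth 0%N s) /\ forall k, A k t x /\ F k t y].
have /choice[H0 HP] := fun s => measurable_hull (E s) sf.
(* Besides minimality up to null sets, [H s] enforces the condition of index [size s] on [x], and it
   is empty unless some [y] satisfies [P s]. The latter does not involve [x], so it costs no
   measurability. *)
pose H s := H0 s `&`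
  (if `[< exists y, P s y >] then A (size s) (nth 0%N s) else set0).
have mH s : measurable (H s).
  by apply: measurableI; [have [] := HP s|case: ifP].
have EH s : E s `<=` H s.
  move=> x Ex; split; first by have [_ + _] := HP s; exact.
  move: Ex => [t [y [ts tP]]].
  rewrite asboolT.
    by have [<- _] := loc _ _ _ ts; have [] := tP (size s).
  exists y => l ls; have [_ <-] : A l t = A l (nth 0%N s) /\ F l t = F l (nth 0%N s).
    by apply: loc => i il; apply: ts; exact: leq_trans il ls.
  by have [] := tP l.
have EU s : E s `<=` \bigcup_a E (rcons s a).
  move=> x [t [y [ts tP]]]; exists (t (size s)) => //; exists t, y; split=> // i.
  rewrite size_rcons ltnS leq_eqVlt nth_rcons => /orP[/eqP ->|is_].
    by rewrite ltnn eqxx.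
  by rewrite is_; exact: ts.
(* Points of [H s] at which no next term is available. The union of the [H (rcons s a)] is a
   measurable superset of [E s], so minimality of the hull makes [D s] null. *)
pose D s := H s `\` \bigcup_a H (rcons s a).
have mUH s : measurable (\bigcup_a H (rcons s a)) by exact: bigcupT_measurable.
have mD s : measurable (D s) by exact: measurableD.
have D0 s : mu.-negligible (D s).
  have [_ _ /(_ _ (mUH s))] := HP s.
  move=> h; apply: negligibleS (h _); first by apply: setSD => x [].
  by apply: subset_trans (EU s) _; apply: subset_bigcup => a _; exact: EH.
pose Z := \bigcup_n D (odflt [::] (unpickle n : option (seq nat))).
have DZ s : D s `<=` Z by move=> x Dx; exists (pickle s) => //; rewrite pickleK.
have Z0 : mu.-negligible Z by exact: negligible_bigcup.
have mZ : measurable Z by exact: bigcupT_measurable.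
pose B := H [::] `\` Z.
have mB : measurable B by exact: measurableD.
(* [seqDU] makes the successors disjoint, so that [next x s] is the least [a] with [x] in
   [H (rcons s a)], if there is one. *)
pose next x s := get (fun a => seqDU (fun a => H (rcons s a)) a x).
have nextE x s a : seqDU (fun a => H (rcons s a)) a x -> next x s = a.
  move=> ax; have := @getI _ (fun a => seqDU (fun a => H (rcons s a)) a x) a ax.
  rewrite -/(next x s) => nx.
  apply: (trivIset_seqDU (fun a => H (rcons s a))) => //.
  by exists x.
have nextP x s : ~ Z x -> H s x ->
    seqDU (fun a => H (rcons s a)) (next x s) x.
  move=> nZ Hs; have : (\bigcup_a H (rcons s a)) x.
    by apply: contrapT => h; apply/nZ/(DZ s).
  by rewrite seqDU_bigcup_eq => -[a _ ax]; rewrite (nextE _ _ _ ax).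
pose br k x := iter k (fun s => rcons s (next x s)) [::].
have HB x k : B x -> H (br k x) x.
  move=> [Hx nZx]; elim: k => // k IH.
  exact: subset_seqDU (nextP _ _ nZx IH).
have size_br x k : size (br k x) = k.
  by elim: k => //= k IH; rewrite size_rcons IH.
have mbr k s : measurable (B `&` [set x | br k x = s]).
  elim: k s => [|k IH] s.
    have [->|s0] := eqVneq s [::].
      by rewrite (_ : [set _ | _] = setT) ?setIT//; apply/seteqP; split.
    rewrite (_ : [set _ | _] = set0) ?setI0//; apply/seteqP; split=> // x /= e.
    by rewrite -e eqxx in s0.
  case: (lastP s) => [|{}s a].
    rewrite (_ : [set _ | _] = set0) ?setI0//; apply/seteqP; split=> // x /=.
    by move=> /(congr1 size); rewrite size_rcons.
  rewrite (_ : _ `&` _ =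
      (B `&` [set x | br k x = s]) `&` seqDU (fun a => H (rcons s a)) a).
    apply: measurableI => //; apply: measurableD => //.
    by apply: bigsetU_measurable.
  apply/seteqP; split=> x [].
    move=> Bx /= /rcons_inj [bs na]; split=> //.
    by rewrite -na bs; apply: nextP; [case: Bx|rewrite -bs; exact: HB].
  by move=> [Bx /= bs] /nextE na; split=> //=; rewrite bs na.
(* The approximation [c s] depends on [s] alone. Hence [h k] takes countably many values, each on a
   measurable set, and is measurable before any limit is taken. *)
pose c s : Y := get (P s).
pose h k x : Y := if x \in B then c (br k x) else 0.
have mh k : measurable_fun setT (h k).
  move=> _ V mV; rewrite setTI.
  rewrite (_ : h k @^-1` V =
    (\bigcup_(s : seq nat)
      (if `[< V (c s) >] then B `&` [set x | br k x = s] else set0))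
    `|` (if `[< V 0 >] then ~` B else set0)).
    apply: measurableU.
      by apply: countable_bigcupT_measurable => // s; case: ifP.
    by case: ifP => // _; exact: measurableC.
  apply/seteqP; split=> x; rewrite /h /=.
    case: ifPn => [/set_mem Bx Vx|/negP Bx Vx]; last first.
      by right; rewrite asboolT// => Bx'; apply: Bx; rewrite inE.
    by left; exists (br k x) => //; rewrite asboolT.
  move=> [[s _]|]; case: ifPn => // /asboolP.
    by move=> Vc [Bx /= bs]; rewrite mem_set// bs.
  by move=> V0 nB; rewrite memNset.
pose t x k := next x (br k x).
have brE x k : br k x = mkseq (t x) k.
  by elim: k => //= k IH; rewrite mkseqS IH /t IH.
have t_agree x k : agree k (t x) (nth 0%N (br k x)).
  by move=> i ik; rewrite brE nth_mkseq.
have AB x k : B x -> A k (t x) x.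
  move=> Bx; have [_] := HB x k Bx; case: ifP => // _.
  by rewrite size_br; have [<- _] := loc _ _ _ (t_agree x k).
have FB x k l : B x -> (l <= k)%N -> F l (t x) (c (br k x)).
  move=> Bx lk; have [_] := HB x k Bx; case: ifP => // /asboolP[y Py] _.
  have := @getI _ (P (br k x)) y Py l; rewrite size_br => /(_ lk).
  suff [_ ->] : A l (t x) = A l (nth 0%N (br k x)) /\
    F l (t x) = F l (nth 0%N (br k x)) by [].
  by apply: loc => i il; apply: t_agree; exact: leq_trans il lk.
have hcvg x : cvg (h^~ x @ \oo).
  have [xB|xB] := boolP (x \in B); last by rewrite /h (negbTE xB); exact: is_cvg_cst.
  rewrite /h xB; apply/cauchy_cvgP/cauchyP => e e0.
  have e2 : 0 < e / 2 by lra.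
  (* From index [K] on, all [c (br k x)] lie in the single set [F K (t x)] of diameter at most
     [e / 2]. *)
  have [K KP] := small (t x) _ e2.
  exists (c (br K x)); apply: filterS (nbhs_infty_ge K) => k /= Kk.
  rewrite -ball_normE /ball_ /=.
  apply: (@le_lt_trans _ _ (e / 2)); last by lra.
  by apply: KP; apply: FB => //; rewrite -inE.
pose v x : Y := lim (h^~ x @ \oo).
exists B, v; split => //.
- apply/measurable_fun_rVP => j.
  apply: (measurable_fun_cvg (h := fun k x => h k x 0 j)).
    by move=> k; have /measurable_fun_rVP := mh k; exact.
  move=> x _; apply: (cvg_comp (h^~ x) (fun w : Y => w 0 j) (hcvg x)).
  exact: coord_continuous.
- move=> x Bx; rewrite GE; exists (t x) => l; split; first exact: AB.
  apply: (closed_cvg (F l (t x)) (cF l (t x)) _ _ (hcvg x)).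
  apply: filterS (nbhs_infty_ge l) => k /= lk.
  by rewrite /h mem_set//; exact: FB.
(* [E [::]] is the projection of [G], so [B] misses at most points of [Z]. *)
- apply: negligibleS Z0 => x [[y Gxy] nB].
  apply: contrapT => nZ; apply: nB; split=> //; apply: EH.
  by move: Gxy; rewrite GE => -[t' tP]; exists t', y; split.
Qed.
End selection.

(** * Tangents and normals in inner product spaces *)

Section dot.
Context {R : realType} {X : lmodType R} (f : {dot X for idfun}).
Implicit Types (U : set X) (u v w z : X).

Lemma dotC u v : f u v = f v u.
Proof. by have := hermC f u v; rewrite expr0 mul1r. Qed.

Lemma dotZl a u v : f (a *: u) v = a * f u v.
Proof. exact: linearZl_LR. Qed.

Lemma dotZr a u v : f u (a *: v) = a * f u v.
Proof. by rewrite dotC dotZl dotC. Qed.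

Lemma dotvv_ge0 u : 0 <= f u u.
Proof. by have [->|/neq0_dnorm_gt0/ltW//] := eqVneq u 0; rewrite linear0l. Qed.

Lemma dnorm_nneg u : 0 <= dnorm f u.
Proof. exact: sqrtr_ge0. Qed.

Lemma dnorm_sqr u : dnorm f u ^+ 2 = f u u.
Proof. by rewrite sqr_sqrtr// dotvv_ge0. Qed.

Lemma dnormZ a u : dnorm f (a *: u) = `|a| * dnorm f u.
Proof.
by rewrite /dnorm dotZl dotZr mulrA -expr2 sqrtrM ?sqr_ge0// sqrtr_sqr.
Qed.

Lemma dnormN u : dnorm f (- u) = dnorm f u.
Proof. by rewrite -scaleN1r dnormZ normrN1 mul1r. Qed.

Lemma dot_cauchy u v : f u v ^+ 2 <= f u u * f v v.
Proof.
have [->|u0] := eqVneq u 0; first by rewrite (linear0l f v) (linear0l f 0) /= expr0n mul0r.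
have uu : 0 < f u u by exact: neq0_dnorm_gt0.
(* The square of this vector is [f u u] times the difference of the two sides. *)
have := dotvv_ge0 (f u u *: v - f u v *: u).
rewrite linearBr !linearBl /= !dotZl !dotZr (dotC v u) => h.
rewrite -subr_ge0 -(pmulr_rge0 _ uu); apply: le_trans h _.
by rewrite le_eqVlt; apply/orP; left; apply/eqP; ring.
Qed.

Lemma dot_le_dnorm u v : f u v <= dnorm f u * dnorm f v.
Proof.
apply: le_trans (ler_norm _) _.
rewrite -(@ler_pXn2r _ 2) ?nnegrE ?mulr_ge0 ?dnorm_nneg//.
by rewrite exprMn !dnorm_sqr real_normK ?num_real// dot_cauchy.
Qed.

Lemma dnormD u v : dnorm f (u + v) <= dnorm f u + dnorm f v.
Proof.
rewrite -(@ler_pXn2r _ 2) ?nnegrE ?addr_ge0 ?dnorm_nneg//.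
rewrite sqrrD !dnorm_sqr linearDr !linearDl /= (dotC v u).
by have := dot_le_dnorm u v; lra.
Qed.

Lemma frechet_normalP U u z : frechet_normal f U u z <->
  forall eta, 0 < eta -> exists2 e, 0 < e & forall v, U v ->
    0 < dnorm f (v - u) < e -> f z (v - u) <= eta * dnorm f (v - u).
Proof.
split=> [h eta eta0|h].
  have [|_ [e /= e0 <-] supe] := ereal_inf_lt (le_lt_trans h (_ : (0 < eta%:E)%E)).
    by rewrite lte_fin.
  exists e => // v Uv /andP[v0 ve]; rewrite -ler_pdivrMr// -lee_fin.
  apply: le_trans (ltW supe).
  by apply: ereal_sup_ubound; exists v => //; split=> //=; rewrite v0.
apply/lee_addgt0Pr => eta eta0; rewrite add0e.
have [e e0 eP] := h _ eta0.
apply: ge_ereal_inf; exists (ereal_sup [set (f z (v - u) / dnorm f (v - u))%:E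
  | v in U `&` [set v | (0 < dnorm f (v - u) < e)%R]]); first by exists e.
apply: ge_ereal_sup => _ [v [Uv /= ve] <-]; rewrite lee_fin ler_pdivrMr.
  exact: eP.
by case/andP: ve.
Qed.

(** A single [e] controls both the scale and the error of the quotient; the sequences are recovered
    with [e = 1 / (i + 1)]. *)
Lemma tangentP U u z : tangent f U u z <-> forall e, 0 < e ->
  exists t w, [/\ 0 < t < e, U w & dnorm f (t^-1 *: (w - u) - z) < e].
Proof.
split=> [[tau [w [tau0 ctau Uw cw]]] e e0|h].
  have /cvgrPdist_lt/(_ e e0) h1 := ctau.
  have /cvgrPdist_lt/(_ e e0) h2 := cw.
  have [i [/=]] := filter_ex (filterI h1 h2).
  rewrite !sub0r !normrN !ger0_norm ?dnorm_nneg// ?ltW// => ti wi.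
  by exists (tau i), (w i); rewrite tau0.
have /choice[tau /choice[w tw]] : forall i : nat, exists t w,
    [/\ 0 < t < i.+1%:R^-1, U w & dnorm f (t^-1 *: (w - u) - z) < i.+1%:R^-1].
  by move=> i; apply: h; rewrite invr_gt0.
have cvg0 (a : nat -> R) : (forall i, 0 <= a i < i.+1%:R^-1) ->
    a i @[i --> \oo] --> 0.
  move=> ha; apply/cvgrPdist_lt => e /natSinv_lt[k kP].
  apply: filterS (nbhs_infty_ge k) => i /= ki.
  have /andP[a0 ai] := ha i.
  by rewrite sub0r normrN ger0_norm// (lt_trans ai)// kP.
exists tau, w; split.
- by move=> i; have [/andP[]] := tw i.
- by apply: cvg0 => i; have [/andP[/ltW -> ->]] := tw i.
- by move=> i; have [] := tw i.
- by apply: cvg0 => i; rewrite dnorm_nneg; have [] := tw i.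
Qed.

(** The form in which derivability is used: it provides points at every small scale and not only
    along some sequence of scales. The curve is forgotten, since points are later selected
    separately at each scale. *)
Lemma derivable_tangent_near U u z : derivable_tangent f U u z ->
  forall e, 0 < e -> exists2 r, 0 < r & forall t, 0 < t < r ->
    exists2 v, U v & dnorm f (t^-1 *: (v - u) - z) < e.
Proof.
move=> [s [xi [s0 Uxi xi0 cxi]]] e e0.
have /cvgrPdist_lt/(_ e e0) := cxi.
rewrite /at_right near_withinE => /nbhs_ballP[r /= r0 rP].
exists (Num.min r s); first by rewrite lt_min r0.
move=> t /andP[t0]; rewrite lt_min => /andP[tr ts].
exists (xi t); first by apply: Uxi; rewrite !ltW.
have := rP t; rewrite /ball /= !sub0r !normrN gtr0_norm// => /(_ tr t0).
by rewrite ger0_norm ?dnorm_nneg// xi0.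
Qed.

End dot.

(** * Euclidean and max norms; directions violating normality *)

Section pointwise.
Context {R : realType} {m : nat}.
Local Notation Y := 'rV[R]_m.

(** Together with [norm_le_dnorm], this transfers compactness and cluster points, which refer to the
    max norm, to the Euclidean norm. *)
Lemma dnorm_le_norm (v : Y) : dnorm dotrV v <= Num.sqrt m%:R * `|v|.
Proof.
rewrite -(@ler_pXn2r _ 2) ?nnegrE ?mulr_ge0 ?sqrtr_ge0 ?dnorm_nneg//.
rewrite dnorm_sqr exprMn sqr_sqrtr ?ler0n// /dotrV.
apply: (@le_trans _ _ (\sum_(j < m) `|v| ^+ 2)).
  apply: ler_sum => j _; rewrite -expr2 -real_normK ?num_real//.
  rewrite ler_pXn2r ?nnegrE// [leRHS]/Num.norm /= mx_normrE.
  by apply/bigmax_geP; right; exists (0, j).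
by rewrite sumr_const card_ord mulr_natl.
Qed.

Lemma norm_le_dnorm (v : Y) : `|v| <= dnorm dotrV v.
Proof.
rewrite [leLHS]/Num.norm /= mx_normrE; apply/bigmax_leP; split; first exact: dnorm_nneg.
move=> [i j] _ /=; rewrite ord1.
rewrite -(@ler_pXn2r _ 2) ?nnegrE ?dnorm_nneg// dnorm_sqr real_normK ?num_real//.
rewrite /= /dotrV (bigD1 j)//= -expr2 lerDl sumr_ge0// => k _.
by rewrite -expr2 sqr_ge0.
Qed.

(* A cluster point of the directions [(v - u) / |v - u|] violating the normal
   inequality is tangent, and derivability realizes it at every scale. *)
Lemma not_frechet_normal (C : set Y) (u z : Y) : C u ->
  geometrically_derivable dotrV C -> ~ frechet_normal dotrV C u z ->
  exists k l : nat, forall i, (l <= i)%N -> exists v, [/\ C v,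
    i.+1%:R^-1 / k.+1%:R < dotrV z (v - u) &
    dotrV (v - u) (v - u) <= 4 * i.+1%:R^-1 ^+ 2].
Proof.
move=> Cu gd nN.
have [eta [eta0 etaP]] : exists eta, 0 < eta /\ forall i : nat, exists v,
    [/\ C v, 0 < dnorm dotrV (v - u) < i.+1%:R^-1 &
        eta * dnorm dotrV (v - u) < dotrV z (v - u)].
  apply: contrapT => h; apply: nN; apply/frechet_normalP => eta eta0.
  apply: contrapT => h2; apply: h; exists eta; split=> // i.
  apply: contrapT => h3; apply: h2; exists (i.+1%:R^-1); first by rewrite invr_gt0.
  move=> v Cv v0; rewrite leNgt; apply/negP => lt; apply: h3.
  by exists v.
have /choice[v_ vP] := etaP.
pose N (v : Y) := dnorm dotrV v.
pose dir i := (N (v_ i - u))^-1 *: (v_ i - u).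
have Ngt0 i : 0 < N (v_ i - u) by have [_ /andP[]] := vP i.
have N1 i : N (dir i) = 1.
  by rewrite /N /dir dnormZ ger0_norm ?invr_ge0 ?ltW// mulVf// gt_eqF.
have zdir i : eta < dotrV z (dir i).
  by have [_ _] := vP i; rewrite /dir dotZr ltr_pdivlMl// mulrC.
have Kc : compact [set v : Y | `|v| <= 1].
  apply: bounded_closed_compact.
    by exists 1; split; [exact: num_real|move=> M M1 v /= /le_trans; apply; exact: ltW].
  have := @closed_closed_ball_ _ Y 0 1.
  by rewrite /closed_ball_; congr closed; apply/funext => v /=; rewrite sub0r normrN.
have [w [_ wcl]] : [set v : Y | `|v| <= 1] `&` cluster (dir i @[i --> \oo]) !=set0.
  apply: Kc; exists 0%N => // i _ /=; rewrite -(N1 i); exact: norm_le_dnorm.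
have near_w e n : 0 < e -> exists2 i, (n <= i)%N & N (dir i - w) < e.
  (* The summand 1 keeps [c] positive when [m = 0]. *)
  move=> e0; pose c := Num.sqrt m%:R + 1 : R.
  have c0 : 0 < c by rewrite /c ltr_wpDl ?sqrtr_ge0.
  have ec0 : 0 < e / c by rewrite divr_gt0.
  have [] := wcl [set dir i | i in [set i | (n <= i)%N]] (ball w (e / c)).
  - by apply: filterS (nbhs_infty_ge n) => i /= ni; exists i.
  - exact: nbhsx_ballx.
  move=> _ [[i /= ni <-]]; rewrite -ball_normE /= => b; exists i => //.
  rewrite /N; apply: le_lt_trans (dnorm_le_norm _) _.
  rewrite -normrN opprB; rewrite ltr_pdivlMr// in b; apply: le_lt_trans b.
  by rewrite mulrC ler_wpM2l// /c lerDl.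
have Tw : tangent dotrV C u w.
  apply/tangentP => e e0; have [k kP] := natSinv_lt e0.
  have [i ki ie] := near_w e k e0.
  exists (N (v_ i - u)), (v_ i); have [Cv /andP[v0 vi] _] := vP i.
  by split=> //; rewrite v0 (lt_trans vi)// kP.
(* This choice gives both [de <= 1/4] and [N z * de <= eta / 4], including when [z = 0]. It serves
   twice: as the distance from [w] to a direction, and as the error of the quotient along the
   curve. *)
pose de := eta / (4 * (N z + eta)).
have Nz : 0 <= N z by exact: dnorm_nneg.
have den0 : 0 < 4 * (N z + eta) by lra.
have de0 : 0 < de by rewrite divr_gt0.
have deP : de * (4 * (N z + eta)) = eta by rewrite /de mulfVK// gt_eqF.
have de4 : de <= 4^-1 by nra.
have zde : N z * de <= eta / 4 by nra.
have [i0 _ wi0] := near_w _ 0%N de0.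
have zw : eta - eta / 4 <= dotrV z w.
  have := dot_le_dnorm dotrV z (dir i0 - w); rewrite linearBr /= -/(N _) -/(N _).
  have := zdir i0; have : N z * N (dir i0 - w) <= N z * de by rewrite ler_wpM2l// ltW.
  by lra.
have Nw : N w <= 1 + 4^-1.
  have := dnormD dotrV (dir i0) (w - dir i0); rewrite addrC subrK.
  by rewrite -(dnormN dotrV (_ - _)) opprB -!/(N _) N1; lra.
have [r r0 rP] := derivable_tangent_near (gd u Cu w Tw) de0.
have [l lP] := natSinv_lt r0.
have [k /(_ k (leqnn k)) kP] := natSinv_lt (divr_gt0 eta0 (ltr0n _ 2)).
exists k, l => i li.
have t0 : 0 < i.+1%:R^-1 :> R by rewrite invr_gt0.
have [|v Cv] := rP i.+1%:R^-1; first by rewrite t0 lP.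
rewrite invrK -/(N _) => vw.
set t := i.+1%:R^-1 in t0 *.
(* The error of the quotient, of norm less than [de]. Thus [z . (w + x) >= eta / 2 > 1 / (k + 1)]
   and [|w + x| <= 3/2 < 2], which yields the two bounds after scaling by [t]. *)
pose x := i.+1%:R *: (v - u) - w.
have vE : v - u = t *: (w + x).
  by rewrite /x (addrC w) subrK scalerA /t mulVf ?scale1r// pnatr_eq0.
exists v; split=> //.
- rewrite vE dotZr linearDr /= ltr_pM2l//; apply: lt_le_trans kP _.
  have := dot_le_dnorm dotrV z (- x); rewrite linearNr /= dnormN -/(N _) -/(N _).
  have : N z * N x <= N z * de by rewrite ler_wpM2l// ltW.
  by lra.
- rewrite -dnorm_sqr vE dnormZ gtr0_norm// exprMn mulrC ler_wpM2r ?sqr_ge0//.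
  have := dnormD dotrV w x; rewrite -!/(N _).
  have := dnorm_nneg dotrV (w + x); rewrite -!/(N _) => *.
  rewrite (_ : 4 = 2 ^+ 2); last by ring.
  by rewrite ler_pXn2r ?nnegrE//; lra.
Qed.

End pointwise.

(** * Integration and L^2 *)

Section integrals.
Context d (T : measurableType d) (R : realType).
Variable mu : {measure set T -> \bar R}.

Lemma integral_dominated_cvg0 (f : nat -> T -> R) (g : T -> R) :
  (forall n, measurable_fun setT (f n)) ->
  (forall n x, 0 <= f n x <= g x) ->
  mu.-integrable setT (EFin \o g) ->
  {ae mu, forall x, f n x @[n --> \oo] --> 0} ->
  forall e : R, 0 < e -> \forall n \near \oo, (\int[mu]_x (f n x)%:E < e%:E)%E.
Proof.
move=> mf fg ig f0 e e0.
have [_ _] : [/\ mu.-integrable setT (cst 0%E),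
    [sequence (\int[mu]_x `|(f n x)%:E - 0|)%E]_n @ \oo --> 0%E &
    [sequence (\int[mu]_x (f n x)%:E)%E]_n @ \oo --> (\int[mu]_(x in setT) 0)%E].
  apply: (dominated_convergence _ _ _ _ ig) => //.
  - by move=> n; apply/measurable_EFinP.
  - apply: filterS f0 => x f0 _; by apply: cvg_EFin => //; exact: nearW.
  - apply/aeW => x n _ /=; have /andP[f0x fgx] := fg n x.
    by rewrite lee_fin ger0_norm.
rewrite integral0 => /fine_cvgP[fin /cvgrPdist_lt/(_ e e0)] h.
apply: filterS (filterI fin h) => n [fn] /=.
rewrite sub0r normrN => /(le_lt_trans (ler_norm _)).
by rewrite -lte_fin fineK.
Qed.

Lemma integral_scale_indic (c : R) (Q : set T) : 0 <= c -> measurable Q ->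
  (\int[mu]_x (c * \1_Q x)%:E = c%:E * mu Q)%E.
Proof.
move=> c0 mQ; under eq_integral do rewrite EFinM.
rewrite ge0_integralZl//; last by apply/measurable_EFinP; exact: measurable_indic.
by rewrite integral_indic// setIT.
Qed.

Lemma measurable_mem (Q : set T) : measurable Q ->
  measurable_fun setT (fun x => x \in Q).
Proof.
move=> mQ; apply: (measurable_fun_bool true).
rewrite (_ : _ `&` _ = Q)//; apply/seteqP; split=> x /=.
  by move=> [_ /set_mem].
by move=> /mem_set.
Qed.

End integrals.

Lemma nneseries_cvg0 (R : realType) (a : nat -> R) : (forall i, 0 <= a i) ->
  (\sum_(0 <= i <oo) (a i)%:E < +oo)%E -> a i @[i --> \oo] --> 0.
Proof.
move=> a0 aoo; apply: cvg_series_cvg_0; apply: nondecreasing_is_cvgn.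
  apply/nondecreasing_seqP => n; rewrite /series /= big_nat_recr//= lerDl//.
exists (fine (\sum_(0 <= i <oo) (a i)%:E)%E) => _ [n _ <-].
rewrite -lee_fin fineK; last first.
  by rewrite ge0_fin_numE//; apply: nneseries_ge0 => i _ _; rewrite lee_fin.
by rewrite /series /= -sumEFin; apply: nneseries_lim_ge => i _ _; rewrite lee_fin.
Qed.

Section L2_lemmas.
Context d (T : measurableType d) (R : realType).
Variables (mu : {measure set T -> \bar R}) (m : nat).
Local Notation L2m := (L2 mu m).
Local Notation Y := 'rV[R]_m.

Lemma integrable_dotL2 (u v : L2m) :
  mu.-integrable setT (fun x => (dotrV (u x) (v x))%:E).
Proof.
by apply: integrable_dotrV;
  [exact: measurable_L2|exact: measurable_L2|exact: L2_sq_integrable|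
   exact: L2_sq_integrable].
Qed.

Lemma dotL2_integral (u v : L2m) (h : T -> R) : measurable_fun setT h ->
  {ae mu, forall x, dotrV (u x) (v x) = h x} ->
  (dotL2 u v)%:E = (\int[mu]_x (h x)%:E)%E.
Proof.
move=> mh uvh; rewrite /dotL2 /Rintegral fineK; last first.
  exact: integrable_fin_num (integrable_dotL2 u v).
apply: ae_eq_integral => //.
- exact: measurable_int (integrable_dotL2 u v).
- exact/measurable_EFinP.
- by apply: filterS uvh => x -> _.
Qed.

Lemma measurable_dotL2 (u v : L2m) :
  measurable_fun setT (fun x => dotrV (u x) (v x)).
Proof. by apply: measurable_dotrV; exact: measurable_L2. Qed.

Lemma L2_subE (u v : L2m) : {ae mu, forall x, (u - v) x = u x - v x}.
Proof.
rewrite -scaleN1r.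
apply: filterS (filterI (L2_addE u (-1 *: v)) (L2_scaleE (-1) v)) => x [-> ->].
by rewrite scaleN1r.
Qed.

(** The sum of the squares has a finite integral, hence is finite a.e., and its terms tend to 0. For
    sequences chosen with this decay no subsequence has to be extracted. *)
Lemma L2_fast_cvg0 (w : nat -> L2m) :
  (forall i, dotL2 (w i) (w i) <= (2 ^ i.+1)%:R^-1) ->
  {ae mu, forall x, dotrV (w i x) (w i x) @[i --> \oo] --> 0}.
Proof.
move=> w2.
have mw i : measurable_fun setT (fun x => (dotrV (w i x) (w i x))%:E).
  by apply/measurable_EFinP; exact: measurable_dotL2.
have w0 i x : setT x -> (0 <= (dotrV (w i x) (w i x))%:E)%E.
  by rewrite lee_fin dotrVv_ge0.
have ms : measurable_fun setT (fun x =>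
    \sum_(0 <= i <oo) (dotrV (w i x) (w i x))%:E)%E.
  by apply: ge0_emeasurable_sum => // i x _ _; exact: w0.
have s0 x : (0 <= \sum_(0 <= i <oo) (dotrV (w i x) (w i x))%:E)%E.
  by apply: nneseries_ge0 => i _ _; exact: w0.
have isum : mu.-integrable setT (fun x =>
    \sum_(0 <= i <oo) (dotrV (w i x) (w i x))%:E)%E.
  apply/integrableP; split=> //.
  under eq_integral do rewrite gee0_abs//.
  rewrite integral_nneseries//.
  apply: (@le_lt_trans _ _ (\sum_(0 <= i <oo) (1 / (2 ^ i.+1)%:R)%:E)%E).
    apply: lee_nneseries => [i _ _|i _].
      by apply: integral_ge0 => x; exact: w0.
    rewrite -(dotL2_integral (u := w i) (v := w i) (measurable_dotL2 _ _)).
      by rewrite lee_fin div1r.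
    exact: aeW.
  by apply: le_lt_trans (epsilon_trick0 xpredT ler01) _; rewrite ltry.
apply: filterS (integrable_ae measurableT isum) => x /(_ Logic.I) sx.
apply: nneseries_cvg0 => [i|]; first exact: dotrVv_ge0.
by rewrite -ge0_fin_numE.
Qed.

(** A selection [v] need not be square-integrable, but [v - u] cut off to [Q] is bounded with
    support of finite measure; it is added to [u]. *)
Lemma L2_patch (u : L2m) (v : T -> Y) (Q : set T) (M : R) :
  measurable Q -> (mu Q < +oo)%E -> measurable_fun setT v -> 0 <= M ->
  (forall x, Q x -> dotrV (v x - u x) (v x - u x) <= M) ->
  exists w : L2m,
    {ae mu, forall x, (w - u) x = if x \in Q then v x - u x else 0} /\
    {ae mu, forall x, w x = if x \in Q then v x else u x}.
Proof.
move=> mQ Qoo mv M0 vM.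
pose h x := if x \in Q then v x - u x else 0.
have mh : measurable_fun setT h.
  apply: measurable_fun_ifT; first exact: measurable_mem.
    rewrite (_ : (fun x => _) = (fun x => v x + -1 *: u x)).
      apply: measurable_rVD => //; apply: measurable_rVZ; exact: measurable_L2.
    by apply/funext => x; rewrite scaleN1r.
  exact: measurable_cst.
have ih : sq_integrable mu h.
  rewrite /sq_integrable; apply: (@le_lt_trans _ _ (\int[mu]_x (M * \1_Q x)%:E)%E).
    apply: ge0_le_integral => //.
    - by move=> x _; rewrite lee_fin dotrVv_ge0.
    - by apply/measurable_EFinP; exact: measurable_dotrV.
    - by apply/measurable_EFinP; apply: measurable_funM => //; exact: measurable_indic.
    - move=> x _; rewrite lee_fin /h indicE; case: ifPn => [/set_mem/vM|_].
        by rewrite mulr1.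
      by rewrite mulr0 /dotrV big1// => j _; rewrite mxE mul0r.
  by rewrite integral_scale_indic// lte_mul_pinfty.
exists (u + mkL2 mh ih); split.
  by rewrite addrAC subrr add0r; exact: mkL2E.
apply: filterS (filterI (L2_addE u (mkL2 mh ih)) (mkL2E mh ih)) => x [-> ->].
by rewrite /h; case: ifP => _; rewrite ?addr0// addrC subrK.
Qed.

End L2_lemmas.

Lemma measurable_lt_set d (T : measurableType d) (R : realType) (f g : T -> R) :
  measurable_fun setT f -> measurable_fun setT g ->
  measurable [set x | f x < g x].
Proof.
move=> mf mg; rewrite (_ : [set x | f x < g x] =
  setT `&` (fun x => f x < g x) @^-1` [set true]); last by rewrite setTI.
exact: measurable_fun_ltr.
Qed.

Lemma measurable_le_set d (T : measurableType d) (R : realType) (f g : T -> R) :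
  measurable_fun setT f -> measurable_fun setT g ->
  measurable [set x | f x <= g x].
Proof.
move=> mf mg; rewrite (_ : [set x | f x <= g x] =
  setT `&` (fun x => f x <= g x) @^-1` [set true]); last by rewrite setTI.
exact: measurable_fun_ler.
Qed.

(** * Pointwise description of tangents and normals *)

Section decomposable.
Context d (T : measurableType d) (R : realType) (m : nat).
Variable mu : {measure set T -> \bar R}.
Variable C : T -> set 'rV[R]_m.
Local Notation L2m := (L2 mu m).
Local Notation Y := 'rV[R]_m.
Let U : set L2m := [set u : L2m | {ae mu, forall x, C x (u x)}].
Implicit Types u z w : L2m.

Let quotE (a : R) w u z :
  {ae mu, forall x, (a *: (w - u) - z) x = a *: (w x - u x) - z x}.
Proof.
apply: filterS (filterI (L2_subE (a *: (w - u)) z)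
  (filterI (L2_scaleE a (w - u)) (L2_subE w u))) => x.
by move=> [-> [-> ->]].
Qed.

(** Quotients with errors below [2 ^- (i + 1)] are picked, so that they converge a.e. along the
    whole sequence. As these bounds are at most 1, they also bound the squared norms. *)
Lemma tangent_ae u z : tangent dotL2 U u z ->
  {ae mu, forall x, tangent dotrV (C x) (u x) (z x)}.
Proof.
move=> /tangentP h.
have /choice[t /choice[w tw]] : forall i : nat, exists t w,
    [/\ 0 < t < (2 ^ i.+1)%:R^-1, U w &
        dnorm dotL2 (t^-1 *: (w - u) - z) < (2 ^ i.+1)%:R^-1].
  by move=> i; apply: h; rewrite invr_gt0 ltr0n expn_gt0.
have e0 : {ae mu, forall x, dotrV (((t i)^-1 *: (w i - u) - z) x)
    (((t i)^-1 *: (w i - u) - z) x) @[i --> \oo] --> 0}.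
  apply: (@L2_fast_cvg0 _ _ _ mu m (fun i => (t i)^-1 *: (w i - u) - z)) => i.
  have [_ _ /ltW wi] := tw i.
  set n := (2 ^ i.+1)%:R^-1 in wi *.
  have n0 : 0 <= n by rewrite invr_ge0.
  have n1 : n <= 1 by rewrite invf_le1 ?ltr0n ?expn_gt0// ler1n expn_gt0.
  have := dnorm_sqr dotL2 ((t i)^-1 *: (w i - u) - z); rewrite /= => <-.
  have := dnorm_nneg dotL2 ((t i)^-1 *: (w i - u) - z); nra.
have Cw : {ae mu, forall x, forall i, C x (w i x)}.
  by apply: ae_foralln => i; have [] := tw i.
have ew : {ae mu, forall x, forall i, ((t i)^-1 *: (w i - u) - z) x =
    (t i)^-1 *: (w i x - u x) - z x}.
  by apply: ae_foralln => i; exact: quotE.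
apply: filterS (filterI e0 (filterI Cw ew)) => x [{}e0 [{}Cw {}ew]].
apply/tangentP => e ee.
have [k kP] := natSinv_lt ee.
have e2 : 0 < e ^+ 2 by rewrite exprn_gt0.
have /cvgrPdist_lt/(_ _ e2) := e0.
move=> /(filterI (nbhs_infty_ge k))/filter_ex[i [/= ki]].
rewrite sub0r normrN ger0_norm ?dotrVv_ge0// ew => ei.
exists (t i), (w i x); split=> //.
  have [/andP[-> ti] _ _] := tw i; rewrite (lt_trans ti)//.
  apply: le_lt_trans (kP i ki).
  by rewrite lef_pV2 ?posrE ?ltr0n ?expn_gt0// ler_nat ltnW// ltn_expl.
rewrite -(@ltr_pXn2r _ 2) ?nnegrE ?dnorm_nneg ?ltW//.
by rewrite dnorm_sqr.
Qed.

(* Along a sequence violating the normal inequality by [eta], the functions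
   [g = ((z . dv)^+ / |dv|)^2] are bounded by [|z|^2] and tend to 0 a.e., while
   AM-GM forces their integrals to stay above [eta ^ 2]. *)
Lemma frechet_normal_of_ae u z :
  {ae mu, forall x, frechet_normal dotrV (C x) (u x) (z x)} ->
  frechet_normal dotL2 U u z.
Proof.
move=> Nz; apply/frechet_normalP => eta eta0; apply: contrapT => hn.
have /choice[v vP] : forall i : nat, exists v, [/\ U v,
    0 < dnorm dotL2 (v - u) < (2 ^ i.+1)%:R^-1 &
    eta * dnorm dotL2 (v - u) < dotL2 z (v - u)].
  move=> i; apply: contrapT => h; apply: hn.
  exists (2 ^ i.+1)%:R^-1; first by rewrite invr_gt0 ltr0n expn_gt0.
  move=> v Uv v0; rewrite leNgt; apply/negP => lt; apply: h.
  by exists v.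
have dv0 : {ae mu, forall x, dotrV ((v i - u) x) ((v i - u) x) @[i --> \oo] --> 0}.
  apply: (@L2_fast_cvg0 _ _ _ mu m (fun i => v i - u)) => i.
  have [_ /andP[_ /ltW vi] _] := vP i.
  set n := (2 ^ i.+1)%:R^-1 in vi *.
  have n0 : 0 <= n by rewrite invr_ge0.
  have n1 : n <= 1 by rewrite invf_le1 ?ltr0n ?expn_gt0// ler1n expn_gt0.
  have := dnorm_sqr dotL2 (v i - u); rewrite /= => <-.
  have := dnorm_nneg dotL2 (v i - u); nra.
have Cv : {ae mu, forall x, forall i, C x (v i x)}.
  by apply: ae_foralln => i; have [] := vP i.
have dvE : {ae mu, forall x, forall i, (v i - u) x = v i x - u x}.
  by apply: ae_foralln => i; exact: L2_subE.
pose p i x := Num.max 0 (dotrV (z x) ((v i - u) x)).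
pose q i x := dotrV ((v i - u) x) ((v i - u) x).
(* The quotient [p ^ 2 / q], with the inverse written as a real power for measurability. Where [q]
   vanishes so does [p], and [g] is 0 there. *)
pose g i x := p i x ^+ 2 * (q i x) `^ (-1).
have q0 i x : 0 <= q i x by exact: dotrVv_ge0.
have gE i x : g i x = p i x ^+ 2 / q i x by rewrite /g powR_inv1.
have p0 i x : 0 <= p i x by rewrite /p le_max lexx.
have p2 i x : p i x ^+ 2 <= dotrV (z x) (z x) * q i x.
  rewrite /p; case: (leP 0 (dotrV (z x) ((v i - u) x))) => _.
    exact: (dot_cauchy dotrV).
  by rewrite expr0n/=; apply: mulr_ge0; [exact: dotrVv_ge0|exact: q0].
have pq i x : q i x = 0 -> p i x = 0.
  move=> qz; have := p2 i x; rewrite qz mulr0 => h.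
  by apply/eqP; rewrite -sqrf_eq0 eq_le h sqr_ge0.
have mp i : measurable_fun setT (p i).
  by apply: measurable_maxr; [exact: measurable_cst|exact: measurable_dotL2].
have mq i : measurable_fun setT (q i) by exact: measurable_dotL2.
have mg i : measurable_fun setT (g i).
  apply: measurable_funM; first exact: measurable_funX.
  by apply: (measurableT_comp (measurable_powR (-1))); exact: mq.
have g0 i x : 0 <= g i x by rewrite gE divr_ge0// sqr_ge0.
have gz i x : g i x <= dotrV (z x) (z x).
  have [qz|qz] := eqVneq (q i x) 0.
    by rewrite gE (pq _ _ qz) expr0n mul0r dotrVv_ge0.
  by rewrite gE ler_pdivrMr ?p2// lt_neqAle eq_sym qz q0.
have gcvg : {ae mu, forall x, g i x @[i --> \oo] --> 0}.
  apply: filterS (filterI Nz (filterI dv0 (filterI Cv dvE))) => x.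
  move=> [/frechet_normalP {}Nz [{}dv0 [{}Cv {}dvE]]].
  apply/cvgrPdist_lt => e e0.
  (* With this tolerance, normality at [x] gives [p ^ 2 <= (e / 2) * q], hence [g <= e / 2]. *)
  have s0 : 0 < Num.sqrt (e / 2) by rewrite sqrtr_gt0 divr_gt0.
  have [r r0 rP] := Nz _ s0.
  have r2 : 0 < r ^+ 2 by rewrite exprn_gt0.
  have /cvgrPdist_lt/(_ _ r2) := dv0.
  apply: filterS => i; rewrite !sub0r !normrN !ger0_norm ?dotrVv_ge0// => qr.
  have [qz|qz] := eqVneq (q i x) 0.
    by rewrite gE (pq _ _ qz) expr0n mul0r.
  have qgt0 : 0 < q i x by rewrite lt_neqAle eq_sym qz q0.
  have qN : dnorm dotrV (v i x - u x) ^+ 2 = q i x.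
    by rewrite dnorm_sqr /= /q dvE.
  have N0 : 0 < dnorm dotrV (v i x - u x).
    by rewrite lt_neqAle dnorm_nneg andbT eq_sym -sqrf_eq0 qN.
  have Nr : dnorm dotrV (v i x - u x) < r.
    by rewrite -(@ltr_pXn2r _ 2) ?nnegrE ?ltW// qN.
  have := rP _ (Cv i); rewrite N0 Nr => /(_ isT) zd.
  have pN : p i x <= Num.sqrt (e / 2) * dnorm dotrV (v i x - u x).
    by rewrite /p dvE ge_max zd mulr_ge0 ?ltW.
  have : p i x ^+ 2 <= e / 2 * q i x.
    rewrite -qN -[e / 2]sqr_sqrtr; last by rewrite ltW// divr_gt0.
    by rewrite -exprMn ler_pXn2r ?nnegrE// mulr_ge0// ltW.
  rewrite gE -ler_pdivrMr// => /le_lt_trans; apply; lra.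
have iz := integrable_dotL2 z z.
have eta2 : 0 < eta ^+ 2 by rewrite exprn_gt0.
have := integral_dominated_cvg0 mg _ iz gcvg eta2.
move=> /(_ _)/filter_ex[|i]; first by move=> n x; rewrite g0 gz.
have ig : mu.-integrable setT (EFin \o g i).
  apply: le_integrable iz => //; first exact/measurable_EFinP.
  by move=> x _ /=; rewrite lee_fin !ger0_norm ?dotrVv_ge0.
have [_ /andP[r0 _] lt] := vP i.
set r := dnorm dotL2 (v i - u) in r0 lt.
have iq := integrable_dotL2 (v i - u) (v i - u).
have qr : \int[mu]_x q i x = r ^+ 2 by rewrite /r dnorm_sqr.
have -> : (\int[mu]_x (g i x)%:E)%E = (\int[mu]_x g i x)%:E.
  by rewrite /Rintegral fineK//; exact: integrable_fin_num ig.
rewrite lte_fin => gint.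
have Ig a : mu.-integrable setT (EFin \o (fun x => a * g i x)).
  apply: eq_integrable (integrableZl measurableT a ig) => //.
have Iq a : mu.-integrable setT (EFin \o (fun x => a * q i x)).
  apply: eq_integrable (integrableZl measurableT a iq) => //.
(* AM-GM, with weights such that each of the two terms contributes at most [eta * r / 2]: the [q]
   term exactly, since [q] has integral [r ^ 2], and the [g] term strictly less. The sum stays below
   [eta * r], against the choice of [v i]. *)
have : dotL2 z (v i - u) <=
    \int[mu]_x ((r / (2 * eta)) * g i x + (eta / (2 * r)) * q i x).
  apply: le_Rintegral => //.
  - exact: integrable_dotL2.
  - exact: integrableD (Ig _) (Iq _).
  - move=> x _; apply: (@le_trans _ _ (p i x)); first by rewrite /p le_max lexx orbT.
    have [qz|qz] := eqVneq (q i x) 0.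
      by rewrite gE qz (pq _ _ qz) expr0n/= mul0r !mulr0 addr0.
    have qgt0 : 0 < q i x by rewrite lt_neqAle eq_sym qz q0.
    rewrite gE -subr_ge0.
    have -> : r / (2 * eta) * (p i x ^+ 2 / q i x) + eta / (2 * r) * q i x - p i x
      = (r * p i x - eta * q i x) ^+ 2 / (2 * eta * r * q i x).
      by field; rewrite !gt_eqF.
    by rewrite divr_ge0 ?sqr_ge0// !mulr_ge0// ltW.
rewrite RintegralD//.
rewrite !RintegralZl// qr => le.
have := lt_le_trans lt le.
have -> : eta / (2 * r) * r ^+ 2 = eta * r / 2 by field; rewrite gt_eqF.
have : r / (2 * eta) * \int[mu]_x g i x < r / (2 * eta) * eta ^+ 2.
  by rewrite ltr_pM2l// divr_gt0// mulr_gt0.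
have -> : r / (2 * eta) * eta ^+ 2 = eta * r / 2 by field; rewrite gt_eqF.
by lra.
Qed.

(** * Arguments by selection from the graph of [C] *)

Section graph.
Variable D : set T.
Hypotheses (sf : sigma_finite setT mu) (aeD : {ae mu, forall x, D x})
  (mC : measurable [set p : T * Y | D p.1 /\ C p.1 p.2])
  (gdC : {ae mu, forall x, geometrically_derivable dotrV (C x)}).

(** The graph is known to be measurable over [D] only; as [D] has full measure, the a.e. conclusion
    no longer mentions it. *)
Let selection (P : T -> Y -> Prop) :
  measurable [set p : T * Y | P p.1 p.2] ->
  exists (B : set T) (v : T -> Y), [/\ measurable B, measurable_fun setT v,
    forall x, B x -> C x (v x) /\ P x (v x) &
    {ae mu, forall x, (exists y, C x y /\ P x y) -> B x}].
Proof.
move=> mP.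
have [B [v [mB mv Bv neg]]] := measurable_selection sf (measurableI _ _ mC mP).
exists B, v; split=> // [x /Bv[[]]//|].
have h : {ae mu, forall x, (exists y, (D x /\ C x y) /\ P x y) -> B x}.
  by apply: negligibleS neg => x /= /not_implyP.
by apply: filterS (filterI aeD h) => x [Dx {}h] [y [Cy Py]]; apply: h; exists y.
Qed.

Let measurable_fstL2 (u : L2m) : measurable_fun setT (fun p : T * Y => u p.1).
Proof. exact: measurableT_comp (measurable_L2 u) measurable_fst. Qed.

Let measurable_subL2 (u : L2m) : measurable_fun setT (fun p : T * Y => p.2 - u p.1).
Proof.
rewrite (_ : (fun p => _) = (fun p : T * Y => p.2 + -1 *: u p.1)).
  by apply: measurable_rVD; [exact: measurable_snd|exact: measurable_rVZ].
by apply/funext => p; rewrite scaleN1r.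
Qed.

Let exhaustion (z : L2m) : exists F : nat -> set T, [/\ forall n, measurable (F n),
  forall n, (mu (F n) < +oo)%E, forall n x, F n x -> dotrV (z x) (z x) <= n%:R &
  forall x, \forall n \near \oo, F n x].
Proof.
have /sigma_finiteP[F [UF ndF mF]] := sf.
pose Z n := [set x | dotrV (z x) (z x) <= n%:R].
have mZ n : measurable (Z n).
  by apply: measurable_le_set => //; exact: measurable_dotL2.
exists (fun n => F n `&` Z n); split.
- by move=> n; apply: measurableI => //; have [] := mF n.
- move=> n; have [mFn] := mF n; apply: le_lt_trans.
  by apply: le_measure; rewrite ?inE//; exact: measurableI.
- by move=> n x [].
- move=> x; have [k _ Fk] : (\bigcup_n F n) x by rewrite -UF.
  have [j zj] : exists j : nat, dotrV (z x) (z x) <= j%:R.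
    exists (Num.Def.archi_bound (dotrV (z x) (z x))).
    by apply/ltW/archi_boundP; exact: dotrVv_ge0.
  apply: filterS (filterI (nbhs_infty_ge k) (nbhs_infty_ge j)) => n [/= kn jn].
  split; first by move: Fk; exact/subsetPset/ndF.
  by rewrite /Z /= (le_trans zj)// ler_nat.
Qed.

(** Dominated convergence with bound [|z|^2]: at almost every point the integrand is eventually
    0. *)
Let tail_small (z : L2m) (P : nat -> set T) e : (forall n, measurable (P n)) ->
  {ae mu, forall x, \forall n \near \oo, P n x} -> 0 < e ->
  \forall n \near \oo,
    (\int[mu]_x (if x \in P n then 0 else dotrV (z x) (z x))%:E < e%:E)%E.
Proof.
move=> mP aeP e0.
apply: (integral_dominated_cvg0 _ _ (integrable_dotL2 z z)) => //.
- move=> n; apply: measurable_fun_ifT; first exact: measurable_mem.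
    exact: measurable_cst.
  exact: measurable_dotL2.
- by move=> n x; case: ifP; rewrite ?lexx dotrVv_ge0.
- apply: filterS aeP => x Px.
  apply/cvgrPdist_lt => r r0; apply: filterS Px => n Pnx.
  by rewrite mem_set// subrr normr0.
Qed.

(** The squared error is split into three parts below [a = e ^ 2 / 3]. On [Q] intersected with [B i]
    the selected quotient is close to [z]; off [Q] and off [B i] the function [u] is kept and the
    error is [|z|^2], a small tail. The order of choices is [Q], then [c], then [i]. *)
Lemma tangent_of_ae u z : U u ->
  {ae mu, forall x, tangent dotrV (C x) (u x) (z x)} ->
  tangent dotL2 U u z.
Proof.
move=> Uu aeT; apply/tangentP => e e0.
pose a := e ^+ 2 / 3.
have a0 : 0 < a by rewrite divr_gt0// exprn_gt0.
have [F [mF Foo Fz nearF]] := exhaustion z.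
have [n Qa] := filter_ex (tail_small z mF (aeW _ nearF) a0).
set Q := F n in Qa.
have mQ : measurable Q by exact: mF.
have Qfin : mu Q \is a fin_num by rewrite ge0_fin_numE//; exact: Foo.
(* The summand 1 makes [c * mu Q < a] strict and covers a null [Q]. *)
pose c := a / (fine (mu Q) + 1).
have mQ0 : 0 <= fine (mu Q) by rewrite fine_ge0.
have c0 : 0 < c by rewrite divr_gt0//; lra.
have cQ : c * fine (mu Q) < a.
  by rewrite /c mulrAC ltr_pdivrMr ?ltr_pM2l//; lra.
pose P i x y := dotrV (i.+1%:R *: (y - u x) - z x) (i.+1%:R *: (y - u x) - z x) < c.
have mP i : measurable [set p : T * Y | P i p.1 p.2].
  apply: measurable_lt_set => //.
  suff h : measurable_fun setT (fun p : T * Y => i.+1%:R *: (p.2 - u p.1) - z p.1).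
    exact: measurable_dotrV.
  rewrite (_ : (fun p => _) =
    (fun p : T * Y => i.+1%:R *: (p.2 - u p.1) + -1 *: z p.1)).
    by apply: measurable_rVD; apply: measurable_rVZ.
  by apply/funext => p; rewrite scaleN1r.
have /choice[B /choice[v Bv]] := fun i => @selection (P i) (mP i).
have mB i : measurable (B i) by have [] := Bv i.
(* Derivability is essential here: a common scale [1 / (i + 1)] must work at most points at once,
   whereas tangency alone gives scales depending on [x]. *)
have aeB : {ae mu, forall x, \forall i \near \oo, B i x}.
  have h : {ae mu, forall x, forall i, (exists y, C x y /\ P i x y) -> B i x}.
    by apply: ae_foralln => i; have [] := Bv i.
  apply: filterS (filterI h (filterI gdC (filterI Uu aeT))) => x.
  move=> [{}h [gd [Cu Tz]]].
  have sc0 : 0 < Num.sqrt c by rewrite sqrtr_gt0.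
  have [r r0 rP] := derivable_tangent_near (gd _ Cu _ Tz) sc0.
  have [k kP] := natSinv_lt r0.
  apply: filterS (nbhs_infty_ge k) => i /= ki; apply: h.
  have [|y Cy yz] := rP i.+1%:R^-1; first by rewrite invr_gt0 ltr0n kP.
  exists y; split=> //; rewrite invrK in yz.
  rewrite /P -dnorm_sqr -[c]sqr_sqrtr ?ltW//.
  by rewrite ltr_pXn2r ?nnegrE ?dnorm_nneg// ltW.
have [k kP] := natSinv_lt e0.
have [i [/= ki Ba]] := filter_ex (filterI (nbhs_infty_ge k) (tail_small z mB aeB a0)).
have [_ mv BC _] := Bv i.
pose t : R := i.+1%:R^-1.
have t0 : 0 < t by rewrite invr_gt0.
(* From [|y|^2 <= 2 * (|y - z|^2 + |z|^2)], with [|z|^2 <= n] on [Q]. *)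
pose M := t ^+ 2 * (2 * (c + n%:R)).
have M0 : 0 <= M by rewrite /M mulr_ge0 ?sqr_ge0// mulr_ge0// addr_ge0// ltW.
have mQB : measurable (Q `&` B i) by exact: measurableI (mF n) (mB i).
have QBoo : (mu (Q `&` B i) < +oo)%E.
  by apply: le_lt_trans (Foo n); apply: le_measure; rewrite ?inE.
have vM x : (Q `&` B i) x -> dotrV (v i x - u x) (v i x - u x) <= M.
  move=> [Qx Bx]; have [_] := BC x Bx; rewrite /P.
  set y := i.+1%:R *: (v i x - u x).
  have -> : v i x - u x = t *: y by rewrite scalerA mulVf ?scale1r// pnatr_eq0.
  move=> yz; rewrite -!(dnorm_sqr dotrV) dnormZ exprMn real_normK ?num_real//.
  rewrite ler_wpM2l ?sqr_ge0//.
  rewrite -(dnorm_sqr dotrV) in yz.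
  have zn := Fz n x Qx; rewrite -(dnorm_sqr dotrV) in zn.
  have := dnormD dotrV (y - z x) (z x); rewrite subrK => yD.
  apply: (@le_trans _ _ ((dnorm dotrV (y - z x) + dnorm dotrV (z x)) ^+ 2)).
    by rewrite ler_pXn2r ?nnegrE ?addr_ge0 ?dnorm_nneg.
  move: yz zn (sqr_ge0 (dnorm dotrV (y - z x) - dnorm dotrV (z x))).
  by rewrite sqrrB sqrrD; lra.
have [w [wu wE]] := L2_patch (Q := Q `&` B i) mQB QBoo mv M0 vM.
exists t, w; split.
- by rewrite t0 kP.
- apply: filterS (filterI wE Uu) => x [-> Cu].
  by case: ifPn => // /set_mem[_ /BC[]].
rewrite -(@ltr_pXn2r _ 2) ?nnegrE ?dnorm_nneg ?ltW// dnorm_sqr /= -lte_fin.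
pose h x := if x \in Q `&` B i
  then dotrV (i.+1%:R *: (v i x - u x) - z x) (i.+1%:R *: (v i x - u x) - z x)
  else dotrV (z x) (z x).
have mh : measurable_fun setT h.
  apply: measurable_fun_ifT; [exact: measurable_mem| |exact: measurable_dotL2].
  suff hh : measurable_fun setT (fun x => i.+1%:R *: (v i x - u x) - z x).
    exact: measurable_dotrV.
  rewrite (_ : (fun x => _) =
      (fun x => i.+1%:R *: (v i x + -1 *: u x) + -1 *: z x)).
    apply: measurable_rVD; apply: measurable_rVZ; last exact: measurable_L2.
    by apply: measurable_rVD => //; apply: measurable_rVZ; exact: measurable_L2.
  by apply/funext => x; rewrite !scaleN1r.
rewrite (dotL2_integral mh); last first.
  apply: filterS (filterI (quotE t^-1 w u z) wE) => x [-> ->].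
  rewrite /h /t invrK; case: ifP => // _.
  by rewrite subrr scaler0 sub0r linearNr /= linearNl /= opprK.
(* The three parts of the error; their sum dominates [h] also where the regions off [Q] and off
   [B i] overlap. *)
pose h1 x := c * \1_Q x.
pose h2 x := if x \in Q then 0 else dotrV (z x) (z x).
pose h3 x := if x \in B i then 0 else dotrV (z x) (z x).
have m1 : measurable_fun setT h1.
  by apply: measurable_funM => //; exact: measurable_indic.
have m2 : measurable_fun setT h2.
  by apply: measurable_fun_ifT => //; [exact: measurable_mem|exact: measurable_dotL2].
have m3 : measurable_fun setT h3.
  by apply: measurable_fun_ifT => //; [exact: measurable_mem|exact: measurable_dotL2].
have h10 x : 0 <= h1 x by rewrite /h1 indicE mulr_ge0// ltW.
have h20 x : 0 <= h2 x by rewrite /h2; case: ifP => // _; exact: dotrVv_ge0.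
have h30 x : 0 <= h3 x by rewrite /h3; case: ifP => // _; exact: dotrVv_ge0.
apply: (@le_lt_trans _ _ (\int[mu]_x ((h1 x)%:E + ((h2 x)%:E + (h3 x)%:E)))%E).
  apply: ge0_le_integral => //.
  - by move=> x _; rewrite lee_fin /h; case: ifP => _; exact: dotrVv_ge0.
  - exact/measurable_EFinP.
  - by apply: emeasurable_funD; [|apply: emeasurable_funD]; exact/measurable_EFinP.
  move=> x _; rewrite -!EFinD lee_fin /h.
  case: ifPn => [/set_mem[Qx Bx]|].
    have [_ /ltW le] := BC x Bx; apply: le_trans le _.
    by rewrite /h1 indicE mem_set// mulr1 lerDl addr_ge0.
  rewrite in_setI negb_and => /orP[] nx.
    have <- : h2 x = dotrV (z x) (z x) by rewrite /h2 (negbTE nx).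
    by rewrite addrCA lerDl addr_ge0.
  have <- : h3 x = dotrV (z x) (z x) by rewrite /h3 (negbTE nx).
  by rewrite addrA lerDr addr_ge0.
rewrite ge0_integralD//; [|by move=> x _; rewrite lee_fin|exact/measurable_EFinP|
  by move=> x _; rewrite -EFinD lee_fin addr_ge0|
  by apply: emeasurable_funD; exact/measurable_EFinP].
rewrite ge0_integralD//; [|by move=> x _; rewrite lee_fin|exact/measurable_EFinP|
  by move=> x _; rewrite lee_fin|exact/measurable_EFinP].
rewrite integral_scale_indic ?ltW// -[mu Q]fineK// -EFinM.
have -> : e ^+ 2 = a + (a + a) by rewrite /a; field.
rewrite !EFinD; apply: lteD; first by rewrite lte_fin.
exact: lteD.
Qed.

(** By [not_frechet_normal], almost every point where normality fails lies in one of the countably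
    many sets [BB k l], on which the violation has rate [1 / (k + 1)] at all scales from index [l]
    on. It remains to see that each of them is null. *)
Lemma frechet_normal_ae u z : U u -> frechet_normal dotL2 U u z ->
  {ae mu, forall x, frechet_normal dotrV (C x) (u x) (z x)}.
Proof.
move=> Uu /frechet_normalP Nz.
pose P k i x y := i.+1%:R^-1 / k.+1%:R < dotrV (z x) (y - u x) /\
  dotrV (y - u x) (y - u x) <= 4 * i.+1%:R^-1 ^+ 2.
have mP k i : measurable [set p : T * Y | P k i p.1 p.2].
  apply: measurableI.
    by apply: measurable_lt_set => //; exact: measurable_dotrV.
  by apply: measurable_le_set => //; exact: measurable_dotrV.
have /choice[B /choice[v Bv]] := fun ki : nat * nat =>
  @selection (P ki.1 ki.2) (mP ki.1 ki.2).
pose BB k l := \bigcap_i (if (l <= i)%N then B (k, i) else setT).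
have mB ki : measurable (B ki) by have [] := Bv ki.
have mBB k l : measurable (BB k l).
  by apply: bigcapT_measurable => i; case: ifP.
have BB0 k l : mu.-negligible (BB k l).
  apply: contrapT => nBB.
  have [F [mF Foo _ nearF]] := exhaustion z.
  have [n nQ] : exists n, ~ mu.-negligible (BB k l `&` F n).
    apply: contrapT => h; apply: nBB.
    apply: (@negligibleS _ _ _ _ (\bigcup_n (BB k l `&` F n))).
      by move=> x Bx; have [n Fx] := filter_ex (nearF x); exists n.
    by apply: negligible_bigcup => n; apply: contrapT => h'; apply: h; exists n.
  set Q := BB k l `&` F n in nQ.
  have mQ : measurable Q by exact: measurableI.
  have Qoo : (mu Q < +oo)%E.
    by apply: le_lt_trans (Foo n); apply: le_measure; rewrite ?inE// => x [].
  have Qfin : mu Q \is a fin_num by rewrite ge0_fin_numE.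
  pose M := fine (mu Q).
  have muQ : mu Q = M%:E by rewrite fineK.
  have M0 : 0 < M.
    apply: fine_gt0; rewrite Qoo andbT lt_neqAle measure_ge0 andbT.
    by apply/negP => /eqP h; apply: nQ; apply/negligibleP.
  have sM : 0 < Num.sqrt M by rewrite sqrtr_gt0.
  have sM2 : Num.sqrt M ^+ 2 = M by rewrite sqr_sqrtr// ltW.
  (* Patching on [Q] gives [z . (w - u) >= t * M / (k + 1)] and [|w - u| <= 2 * t * sqrt M], a
     quotient of at least [sqrt M / (2 * (k + 1))]; [eta] is half of that. *)
  pose eta := Num.sqrt M / (4 * k.+1%:R).
  have k0 : 0 < k.+1%:R :> R by [].
  have eta0 : 0 < eta by rewrite divr_gt0// mulr_gt0.
  have [e e0 eP] := Nz _ eta0.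
  have es0 : 0 < e / (4 * Num.sqrt M) by rewrite divr_gt0// mulr_gt0.
  have [j /(_ (maxn j l) (leq_maxl _ _))] := natSinv_lt es0.
  set i := maxn j l; set t := i.+1%:R^-1 => te.
  have t0 : 0 < t by rewrite invr_gt0.
  have li : (l <= i)%N by exact: leq_maxr.
  have [_ mv BC _] := Bv (k, i).
  have QB x : Q x -> B (k, i) x by move=> [/(_ i Logic.I)]; rewrite li.
  have c0 : 0 <= 4 * t ^+ 2 by rewrite mulr_ge0// sqr_ge0.
  have vM x : Q x -> dotrV (v (k, i) x - u x) (v (k, i) x - u x) <= 4 * t ^+ 2.
    by move=> /QB/BC[_ []].
  have [w [wu wE]] := L2_patch mQ Qoo mv c0 vM.
  have Uw : U w.
    apply: filterS (filterI wE Uu) => x [-> Cu].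
    by case: ifPn => // /set_mem/QB/BC[].
  have mvu : measurable_fun setT (fun x => v (k, i) x - u x).
    rewrite (_ : (fun x => _) = (fun x => v (k, i) x + -1 *: u x)).
      by apply: measurable_rVD => //; apply: measurable_rVZ; exact: measurable_L2.
    by apply/funext => x; rewrite scaleN1r.
  have le2 : dotL2 (w - u) (w - u) <= 4 * t ^+ 2 * M.
    rewrite -lee_fin EFinM -muQ -(integral_scale_indic mu c0 mQ).
    pose h x := if x \in Q then
      dotrV (v (k, i) x - u x) (v (k, i) x - u x) else 0.
    have mh : measurable_fun setT h.
      apply: measurable_fun_ifT; [exact: measurable_mem| |exact: measurable_cst].
      exact: measurable_dotrV.
    rewrite (dotL2_integral mh); last first.
      apply: filterS wu => x ->; rewrite /h; case: ifP => // _.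
      exact: linear0l.
    apply: ge0_le_integral => //.
    - by move=> x _; rewrite lee_fin /h; case: ifP => // _; exact: dotrVv_ge0.
    - exact/measurable_EFinP.
    - by apply/measurable_EFinP; apply: measurable_funM => //; exact: measurable_indic.
    - move=> x _; rewrite lee_fin /h indicE; case: ifPn => [/set_mem/vM|_].
        by rewrite mulr1.
      by rewrite mulr0.
  have ge1 : t / k.+1%:R * M <= dotL2 z (w - u).
    have tk0 : 0 <= t / k.+1%:R by rewrite divr_ge0// ltW.
    rewrite -lee_fin EFinM -muQ -(integral_scale_indic mu tk0 mQ).
    pose h x := if x \in Q then dotrV (z x) (v (k, i) x - u x) else 0.
    have mh : measurable_fun setT h.
      apply: measurable_fun_ifT; [exact: measurable_mem| |exact: measurable_cst].
      by apply: measurable_dotrV => //; exact: measurable_L2.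
    rewrite (dotL2_integral mh); last first.
      apply: filterS wu => x ->; rewrite /h; case: ifP => // _.
      exact: linear0r.
    apply: ge0_le_integral => //.
    - by move=> x _; rewrite lee_fin mulr_ge0// divr_ge0// ltW.
    - by apply/measurable_EFinP; apply: measurable_funM => //; exact: measurable_indic.
    - exact/measurable_EFinP.
    - move=> x _; rewrite lee_fin /h indicE; case: ifPn => [/set_mem/QB/BC[_ [/ltW + _]]|_].
        by rewrite mulr1.
      by rewrite mulr0.
  have tM : 0 < t / k.+1%:R * M by rewrite mulr_gt0// divr_gt0.
  have Nle : dnorm dotL2 (w - u) <= 2 * t * Num.sqrt M.
    rewrite -(@ler_pXn2r _ 2) ?nnegrE ?dnorm_nneg//; last first.
      by rewrite !mulr_ge0// ltW.
    by rewrite dnorm_sqr !exprMn sM2 (_ : 2 ^+ 2 = 4)//; ring.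
  have N0 : 0 < dnorm dotL2 (w - u).
    (* If [w - u] had norm 0, Cauchy-Schwarz would contradict the positive lower bound on
       [z . (w - u)]. *)
    rewrite lt_neqAle dnorm_nneg andbT; apply/eqP => N0.
    have := dot_le_dnorm dotL2 z (w - u); rewrite -N0 mulr0 leNgt.
    by rewrite (lt_le_trans tM ge1).
  have Ne : dnorm dotL2 (w - u) < e.
    apply: le_lt_trans Nle _.
    move: te; rewrite ltr_pdivlMr ?mulr_gt0// => te.
    by have := mulr_gt0 t0 sM; lra.
  have := eP w Uw; rewrite N0 Ne => /(_ isT) /= le.
  have := le_trans ge1 (le_trans le (ler_wpM2l (ltW eta0) Nle)).
  have -> : eta * (2 * t * Num.sqrt M) = t / k.+1%:R * M / 2.
    by rewrite -[in RHS]sM2 /eta; field; rewrite gt_eqF.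
  by rewrite leNgt ltr_pdivrMr// ltr_pMr// ltr1n.
have nBB : {ae mu, forall x, forall k l, ~ BB k l x}.
  apply: ae_foralln => k; apply: ae_foralln => l.
  by apply: negligibleS (BB0 k l) => x /=; exact: contrapT.
have BvE : {ae mu, forall x, forall k i, (exists y, C x y /\ P k i x y) -> B (k, i) x}.
  by apply: ae_foralln => k; apply: ae_foralln => i; have [] := Bv (k, i).
apply: filterS (filterI nBB (filterI BvE (filterI gdC Uu))) => x.
move=> [{}nBB [{}BvE [gd Cu]]]; apply: contrapT => nN.
have [k [l kl]] := not_frechet_normal Cu gd nN.
apply: (nBB k l) => i _; case: ifPn => // li.
by apply: BvE; have [y [Cy y1 y2]] := kl i li; exists y.
Qed.

End graph.

End decomposable.

(** * Lebesgue measure restricted to the domain, and conclusion *)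

Section lebesgue_on_open.
Context (R : realType) (n : nat) (Omega : set 'rV[R]_n) (oOmega : open Omega).

Lemma lebesgue_on_sigma_finite : sigma_finite setT (lebesgue_on oOmega).
Proof.
have [F UF mF] := sigma_finiteT
  (lebesgue_rV n : {sigma_finite_measure set 'rV[R]_n -> \bar R}).
exists F => // i; have [mFi Foo] := mF i; split=> //.
apply: le_lt_trans Foo; rewrite /lebesgue_on /mrestr /=.
have mO := open_measurable_rV oOmega.
by apply: le_measure; rewrite ?inE//; exact: measurableI.
Qed.

Lemma lebesgue_on_ae : {ae lebesgue_on oOmega, forall x, Omega x}.
Proof.
have mO := open_measurable_rV oOmega.
exists (~` Omega); split=> //; first exact: measurableC.
by rewrite /lebesgue_on /= /mrestr setICl measure0.
Qed.

End lebesgue_on_open.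

Theorem proposition2p4 (R : realType) (n m : nat)
    (Omega : set 'rV[R]_n) (oOmega : open Omega)
    (C : 'rV[R]_n -> set 'rV[R]_m)
    (U : set (L2 (lebesgue_on oOmega) m)) :
  borel_setvalued Omega C ->
  {ae lebesgue_on oOmega, forall x, geometrically_derivable dotrV (C x)} ->
  U = [set u : L2 (lebesgue_on oOmega) m |
        {ae lebesgue_on oOmega, forall x, C x (u x)}] ->
  forall u : L2 (lebesgue_on oOmega) m, U u ->
    frechet_normal dotL2 U u =
      [set z : L2 (lebesgue_on oOmega) m |
        {ae lebesgue_on oOmega,
          forall x, frechet_normal dotrV (C x) (u x) (z x)}] /\
    tangent dotL2 U u =
      [set z : L2 (lebesgue_on oOmega) m |
        {ae lebesgue_on oOmega,
          forall x, tangent dotrV (C x) (u x) (z x)}].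
Proof.
move=> mC gdC UE u; rewrite UE => Uu.
have sf := lebesgue_on_sigma_finite oOmega.
have aeO := lebesgue_on_ae oOmega.
split; apply/seteqP; split=> z.
- exact: (frechet_normal_ae sf aeO mC gdC Uu).
- exact: frechet_normal_of_ae.
- exact: tangent_ae.
- exact: (tangent_of_ae sf aeO mC gdC Uu).
Qed.
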